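(* Let $n\ge 1$ be an integer and let constants $a>0$, $\lambda>L>0$, $p\ge 1$, $A>0$, $\mu_1,\mu_2>0$, $v_{\max}>0$, $v^*\in(0,v_{\max})$, and $\varphi\in\left(0,\frac{\pi}{2}\right)$ with $\cos(\varphi)\ge \frac{v^*}{v_{\max}}$ be given. Let $V:(L,+\infty)\to\mathbb{R}_+$ and $U:(-a,a)\to\mathbb{R}_+$ be $C^2$ functions satisfying $$\lim_{d\to L^+}V(d)=+\infty,\qquad V(d)=0\ \text{ for all } d\ge\lambda,$$ $$\lim_{y\to(-a)^+}U(y)=+\infty,\qquad \lim_{y\to a^-}U(y)=+\infty,\qquad U(0)=0,$$ and let $f\in C^1(\mathbb{R})$ satisfy $\max(x,0)\le f(x)$ for all $x\in\mathbb{R}$. Let $\Omega\subset\mathbb{R}^{4n}$, $H:\Omega\to\mathbb{R}_+$, the feedback laws $u_i$, $F_i$, the functions $k_i$, the functions $b_1,b_2$ and the integer $m$ be as defined in the context. Consider the closed-loop system $$\dot x_i=v_i\cos(\theta_i),\quad \dot y_i=v_i\sin(\theta_i),\quad \dot\theta_i=u_i,\quad \dot v_i=F_i,\qquad i=1,\dots,n,$$ with $u_i=u_i(w)$ and $F_i=F_i(w)$ given by those feedback laws. Then for every $w_0\in\Omega$ there exists a unique solution $w(t)\in\Omega$ of the closed-loop system with initial condition $w(0)=w_0$. The solution $w(t)\in\Omega$ is defined for all $t\ge 0$ and satisfies, for $i=1,\dots,n$, $$\lim_{t\to+\infty}v_i(t)=v^*,\quad \lim_{t\to+\infty}\theta_i(t)=0,\quad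 \lim_{t\to+\infty}u_i(t)=0,\quad \lim_{t\to+\infty}F_i(t)=0,$$ where $u_i(t)$, $F_i(t)$ denote $u_i(w(t))$, $F_i(w(t))$. Moreover, there exist a non-decreasing function $\kappa:\mathbb{R}_+\to[0,a)$ and a non-increasing function $\rho:\mathbb{R}_+\to(L,\lambda]$ (not depending on $w_0$) such that for every $w_0\in\Omega$ the corresponding solution satisfies, for all $t\ge0$ and $i=1,\dots,n$, $$|F_i(t)|\le R(H(w_0))\,v_{\max},$$ $$|u_i(t)|\le \frac{1}{v^*}\Big(\big(\mu_1+R(H(w_0))\big)v_{\max}+b_2\big(\kappa(H(w_0))\big)+m\sqrt{p}\,b_1\big(\rho(H(w_0))\big)\Big),$$ where $R:\mathbb{R}_+\to\mathbb{R}_+$ is defined by $$R(s):=\mu_2+\frac{m}{v^*}b_1(\rho(s))+v_{\max}\frac{\big(A+s\cos(\varphi)(1-\cos(\varphi))\big)\max\{f(z):|z|\le m\,b_1(\rho(s))\}}{Av^*(v_{\max}-v^* )+v^*(v_{\max}\cos(\varphi)-v^* )(1-\cos(\varphi))s}.$$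
   Context: $\mathbb{R}_+=[0,+\infty)$. The state is $w=(x_1,\dots,x_n,y_1,\dots,y_n,\theta_1,\dots,\theta_n,v_1,\dots,v_n)'\in\mathbb{R}^{4n}$ (longitudinal positions, lateral positions, orientations, speeds of $n$ vehicles). For $i,j=1,\dots,n$ put $$d_{i,j}:=\sqrt{(x_i-x_j)^2+p(y_i-y_j)^2}.$$ State space: $$S:=\mathbb{R}^n\times(-a,a)^n\times(-\varphi,\varphi)^n\times(0,v_{\max})^n,\qquad \Omega:=\{w\in S:\ d_{i,j}>L,\ i,j=1,\dots,n,\ j\ne i\}.$$ For $w\in\Omega$ define $$H(w):=\frac12\sum_{i=1}^n(v_i\cos(\theta_i)-v^* )^2+\frac12\sum_{i=1}^n v_i^2\sin^2(\theta_i)+\sum_{i=1}^nU(y_i)+\frac12\sum_{i=1}^n\sum_{j\ne i}V(d_{i,j})+A\sum_{i=1}^n\left(\frac{1}{\cos(\theta_i)-\cos(\varphi)}-\frac{1}{1-\cos(\varphi)}\right).$$ Abbreviate $X_i(w):=\sum_{j\ne i}V'(d_{i,j})\frac{x_i-x_j}{d_{i,j}}$ and $Y_i(w):=\sum_{j\ne i}V'(d_{i,j})\frac{y_i-y_j}{d_{i,j}}$. The feedback laws are, for $w\in\Omega$ and $i=1,\dots,n$, $$k_i(w)=\mu_2+\frac{1}{v^*}X_i(w)+\frac{v_{\max}\cos(\theta_i)}{v^*(v_{\max}\cos(\theta_i)-v^* )}f(-X_i(w)),$$ $$F_i=-\frac{k_i(w)}{\cos(\theta_i)}(v_i\cos(\theta_i)-v^*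 )-\frac{1}{\cos(\theta_i)}X_i(w),$$ $$u_i=-\left(v^*+\frac{A}{v_i(\cos(\theta_i)-\cos(\varphi))^2}\right)^{-1}\Big(\mu_1v_i\sin(\theta_i)+U'(y_i)+p\,Y_i(w)+\sin(\theta_i)F_i\Big).$$ Further, $$b_1(s):=\max\{|V'(d)|:s\le d\le\lambda\}\ \text{ for } s\in(L,\lambda],\qquad b_2(s):=\max\{|U'(y)|:|y|\le s\}\ \text{ for } s\in[0,a).$$ The integer $m\ge2$ is the maximum number of points that can be placed in the region of $\mathbb{R}^2$ bounded by the two concentric ellipses $x^2+py^2=L^2$ and $x^2+py^2=\lambda^2$ (i.e. $L^2\le x^2+py^2\le\lambda^2$) so that any two distinct points $(x,y),(x',y')$ of the collection satisfy $\sqrt{(x-x')^2+p(y-y')^2}\ge L$. *)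

(* Defs.v *)
From HB Require Import structures.
From mathcomp Require Import all_boot all_order all_algebra.
From mathcomp Require Import all_classical all_reals all_analysis.

Set Implicit Arguments.
Unset Strict Implicit.
Unset Printing Implicit Defensive.

Import Order.TTheory GRing.Theory Num.Theory.
Import numFieldNormedType.Exports.

Local Open Scope classical_set_scope.
Local Open Scope ring_scope.

(* For open [D] these conditions only involve the values of [g] on [D], so a
   function given only on [D] may be represented by any extension of it to the
   real line. *)
Definition C_on (R : realType) (k : nat) (D : set R) (g : R -> R) : Prop :=
  (forall j x, (j < k)%N -> D x -> derivable (derive1n j g) x 1) /\
  (forall x, D x -> {for x, continuous (derive1n k g)}).

(* A genuine (attained) maximum; [x0] is a junk value, returned only when [A]
   has no greatest element. *)
Definition maximum d (T : porderType d) (x0 : T) (A : set T) : T :=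
  xget x0 (A `&` ubound A).

(* Derivative relative to [J]: two-sided at interior points of an interval [J],
   one-sided at an end point that belongs to [J]. *)
Definition has_deriv_within (R : realType) (J : set R) (g : R -> R) (t l : R)
    : Prop :=
  (g s - g t) / (s - t) @[s --> within J t^'] --> l.

Section Vehicles.
Context {R : realType} {n : nat}.

(* R^{4n} as (x, y, theta, v), each block in R^n *)
Definition state : Type := ('rV[R]_n * 'rV[R]_n * 'rV[R]_n * 'rV[R]_n)%type.

Definition px (w : state) (i : 'I_n) : R := w.1.1.1 ord0 i.
Definition py (w : state) (i : 'I_n) : R := w.1.1.2 ord0 i.
Definition theta (w : state) (i : 'I_n) : R := w.1.2 ord0 i.
Definition speed (w : state) (i : 'I_n) : R := w.2 ord0 i.

Definition enorm (p : R) (q : R * R) : R :=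
  Num.sqrt (q.1 ^+ 2 + p * q.2 ^+ 2).

Definition dist (p : R) (w : state) (i j : 'I_n) : R :=
  enorm p (px w i - px w j, py w i - py w j).

Definition Omega (a phi vmax L p : R) : set state :=
  [set w | (forall i, [/\ - a < py w i < a, - phi < theta w i < phi
                        & 0 < speed w i < vmax]) /\
           (forall i j, j != i -> L < dist p w i j)].

Definition energy (p A phi vstar : R) (V U : R -> R) (w : state) : R :=
  2^-1 * (\sum_(i < n) (speed w i * cos (theta w i) - vstar) ^+ 2)
  + 2^-1 * (\sum_(i < n) speed w i ^+ 2 * sin (theta w i) ^+ 2)
  + \sum_(i < n) U (py w i)
  + 2^-1 * (\sum_(i < n) \sum_(j < n | j != i) V (dist p w i j))
  + A * (\sum_(i < n) ((cos (theta w i) - cos phi)^-1 - (1 - cos phi)^-1)).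

Definition Xforce (p : R) (V : R -> R) (w : state) (i : 'I_n) : R :=
  \sum_(j < n | j != i)
    derive1 V (dist p w i j) * ((px w i - px w j) / dist p w i j).

Definition Yforce (p : R) (V : R -> R) (w : state) (i : 'I_n) : R :=
  \sum_(j < n | j != i)
    derive1 V (dist p w i j) * ((py w i - py w j) / dist p w i j).

Definition gain (p vmax vstar mu2 : R) (V f : R -> R) (w : state) (i : 'I_n)
    : R :=
  mu2 + vstar^-1 * Xforce p V w i
  + vmax * cos (theta w i) / (vstar * (vmax * cos (theta w i) - vstar))
    * f (- Xforce p V w i).

Definition accel (p vmax vstar mu2 : R) (V f : R -> R) (w : state) (i : 'I_n)
    : R :=
  - (gain p vmax vstar mu2 V f w i / cos (theta w i))
    * (speed w i * cos (theta w i) - vstar)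
  - (cos (theta w i))^-1 * Xforce p V w i.

Definition steer (p A phi vmax vstar mu1 mu2 : R) (V U f : R -> R)
    (w : state) (i : 'I_n) : R :=
  - (vstar + A / (speed w i * (cos (theta w i) - cos phi) ^+ 2))^-1
  * (mu1 * speed w i * sin (theta w i) + derive1 U (py w i)
     + p * Yforce p V w i
     + sin (theta w i) * accel p vmax vstar mu2 V f w i).

(* [w] is a solution on [0, T), 0 < T <= +oo, with w(0) = w0, staying in [D];
   the values of [w] outside [0, T) are irrelevant. *)
Definition is_solution (u F : state -> 'I_n -> R) (D : set state) (w0 : state)
    (T : \bar R) (w : R -> state) : Prop :=
  let J := [set t : R | 0 <= t /\ (t%:E < T)%E] in
  w 0 = w0 /\
  forall t, J t -> D (w t) /\ forall i,
    [/\ has_deriv_within J (fun s => px (w s) i) t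
          (speed (w t) i * cos (theta (w t) i)),
        has_deriv_within J (fun s => py (w s) i) t
          (speed (w t) i * sin (theta (w t) i)),
        has_deriv_within J (fun s => theta (w s) i) t (u (w t) i)
      & has_deriv_within J (fun s => speed (w s) i) t (F (w t) i)].

End Vehicles.
Arguments state : clear implicits.

Section Bounds.
Context {R : realType}.

Definition b1 (lambda : R) (V : R -> R) (s : R) : R :=
  maximum 0 [set `|derive1 V d| | d in [set d | s <= d <= lambda]].

Definition b2 (U : R -> R) (s : R) : R :=
  maximum 0 [set `|derive1 U y| | y in [set y | `|y| <= s]].

Definition packing (p L lambda : R) (k : nat) : Prop :=
  exists q : seq (R * R),
    [/\ uniq q, size q = k,
        (forall z, z \in q ->
           L ^+ 2 <= z.1 ^+ 2 + p * z.2 ^+ 2 <= lambda ^+ 2)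
      & (forall z z', z \in q -> z' \in q -> z != z' ->
           L <= enorm p (z.1 - z'.1, z.2 - z'.2))].

Definition max_packing (p L lambda : R) : nat :=
  maximum 0%N [set k | packing p L lambda k].

Definition Rbound (lambda L p A phi vmax vstar mu2 : R) (V f rho : R -> R)
    (s : R) : R :=
  let m := (max_packing p L lambda)%:R in
  mu2 + m / vstar * b1 lambda V (rho s)
  + vmax *
    ((A + s * cos phi * (1 - cos phi))
       * maximum 0 [set f z | z in [set z | `|z| <= m * b1 lambda V (rho s)]]
     / (A * vstar * (vmax - vstar)
        + vstar * (vmax * cos phi - vstar) * (1 - cos phi) * s)).

End Bounds.

(* Main.v *)
(* The energy H is a Lyapunov function: along solutions its derivative is
   - sum_i (k_i (v_i cos theta_i - vstar)^2 + mu1 (v_i sin theta_i)^2), with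
   k_i >= mu2. Since H is non-increasing, |y_i|, |theta_i| and d_{i,j} stay at a
   distance from the boundary of Omega that depends only on H(w_0); and since
   F_i points inwards at both ends of (0, v_max), the speeds stay in a compact
   subinterval. On a slightly larger box the field is therefore replaced by a
   globally bounded and Lipschitz one (by clamping its arguments), whose solution
   exists for all times and is unique; as it moves with bounded speed and, while
   in the larger box, is confined to the smaller one, it never leaves the larger
   box and so solves the original system. Along this solution every quantity of
   interest is Lipschitz in time, and Barbalat's lemma, applied to H, then to v_i
   and theta_i, gives the limits. The explicit bounds hold pointwise on the
   sublevel sets of H: the vehicles closer than lambda to a given one form a
   packing of the elliptic annulus, so there are at most m of them. *)
Require Import Defs.
From HB Require Import structures.
From mathcomp Require Import all_boot all_order all_algebra.
From mathcomp Require Import all_classical all_reals all_analysis.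
From mathcomp Require Import ring lra.

Set Implicit Arguments.
Unset Strict Implicit.
Unset Printing Implicit Defensive.

Import Order.TTheory GRing.Theory Num.Theory.
Import numFieldNormedType.Exports.

Local Open Scope classical_set_scope.
Local Open Scope ring_scope.

(** * Calculus on the real line *)

Section Calculus.
Context {R : realType}.
Implicit Types (f g h q : R -> R) (a b t s l : R).

(** The longitudinal positions are unbounded, so the sublevel sets of H are not compact: Barbalat's
    lemma takes the place of LaSalle's principle, and every Lipschitz constant must be uniform in x.
    This is possible because x enters the field only through differences, and only through those of
    pairs closer than lambda. H gives no control of the ends of the speed range, since its kinetic
    terms stay finite as v_i tends to 0 or v_max. The missing barrier comes from the shape of the
    feedback: F_i is - k_i v_i plus a positive term, and f(x) >= max(x, 0) keeps k_i >= mu2 whatever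
    the sign of X_i. The bound on k_i from above depends only on H, so the barrier is uniform along
    a solution. The confinement estimates are proved for the true field inside Omega, whereas the
    solution constructed first obeys the cut-off field, and the two are known to agree only in the
    larger box. The estimates are therefore usable only up to a time until which the solution is
    already known to stay there, which is why confinement is obtained by induction on time steps of
    one fixed length. *)

Lemma is_derive1_eq f t l l' : is_derive t 1 f l -> l = l' -> is_derive t 1 f l'.
Proof. by move=> ? <-. Qed.

Lemma is_derive1_cst c t : is_derive t 1 (fun=> c : R) 0.
Proof. exact: is_derive_cst. Qed.

Lemma is_derive1_id t : is_derive t 1 (fun s : R => s) 1.
Proof. exact: is_derive_id. Qed.

Lemma is_derive1D f g t a b : is_derive t 1 f a -> is_derive t 1 g b ->
  is_derive t 1 (fun s => f s + g s) (a + b).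
Proof. by move=> hf hg; exact: (@is_deriveD _ _ _ f g). Qed.

Lemma is_derive1N f t a : is_derive t 1 f a -> is_derive t 1 (fun s => - f s) (- a).
Proof. by move=> hf; exact: (@is_deriveN _ _ _ f). Qed.

Lemma is_derive1B f g t a b : is_derive t 1 f a -> is_derive t 1 g b ->
  is_derive t 1 (fun s => f s - g s) (a - b).
Proof. by move=> hf hg; apply: is_derive1D hf (is_derive1N hg). Qed.

Lemma is_derive1M f g t a b : is_derive t 1 f a -> is_derive t 1 g b ->
  is_derive t 1 (fun s => f s * g s) (a * g t + f t * b).
Proof.
move=> hf hg; apply: (@is_derive1_eq _ _ (f t * b + g t * a)).
by ring.
Qed.

Lemma is_derive1Z c f t a : is_derive t 1 f a ->
  is_derive t 1 (fun s => c * f s) (c * a).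
Proof. by move=> hf; apply: is_derive1_eq (is_derive1M (is_derive1_cst c t) hf) _; ring. Qed.

Lemma is_derive1_sqr f t a : is_derive t 1 f a ->
  is_derive t 1 (fun s => f s ^+ 2) (2 * f t * a).
Proof. by move=> hf; apply: is_derive1_eq (is_derive1M hf hf) _; ring. Qed.

Lemma is_derive1_compose f g t a b : is_derive (g t) 1 f a -> is_derive t 1 g b ->
  is_derive t 1 (fun s => f (g s)) (a * b).
Proof. by move=> hf hg; exact: (@is_derive1_comp _ f g). Qed.

Lemma is_derive1V f t a : f t != 0 -> is_derive t 1 f a ->
  is_derive t 1 (fun s => (f s)^-1) (- (f t) ^- 2 * a).
Proof. by move=> f0 hf; exact: is_deriveV. Qed.

Lemma is_derive1_sum (I : Type) (r : seq I) (P : pred I) (F : I -> R -> R)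
    (dF : I -> R) t :
  (forall i, P i -> is_derive t 1 (F i) (dF i)) ->
  is_derive t 1 (fun s => \sum_(i <- r | P i) F i s) (\sum_(i <- r | P i) dF i).
Proof.
move=> hF; elim: r => [|i r ih].
  rewrite big_nil (_ : (fun s => _) = fun=> 0); first exact: is_derive1_cst.
  by apply/funext => s; rewrite big_nil.
rewrite big_cons (_ : (fun s => _) = fun s =>
  if P i then F i s + \sum_(j <- r | P j) F j s else \sum_(j <- r | P j) F j s).
  by case: ifPn => // Pi; apply: is_derive1D ih; apply: hF.
by apply/funext => s; rewrite big_cons.
Qed.

Lemma is_derive1_continuous f t l : is_derive t 1 f l -> {for t, continuous f}.
Proof.
by move=> hf; apply: differentiable_continuous; apply/derivable1_diffP.
Qed.

Lemma derivable1_deriv f t : derivable f t 1 -> is_derive t 1 f (derive1 f t).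
Proof. by move=> hf; rewrite derive1E; exact: derivableP. Qed.

Lemma within_cc_continuous f a b :
  (forall t, a <= t <= b -> {for t, continuous f}) ->
  {within `[a, b], continuous f}.
Proof.
move=> hf; apply: continuous_in_subspaceT => t.
by rewrite inE/= in_itv/= => /hf.
Qed.

Lemma deriv_mvt f f' a b : a <= b ->
  (forall t, a <= t <= b -> is_derive t 1 f (f' t)) ->
  exists2 c, a <= c <= b & f b - f a = f' c * (b - a).
Proof.
move=> ab hf.
have [|c|c] := @MVT_segment R f f' a b ab.
- by move=> x; rewrite in_itv/= => /andP[ax xb]; apply: hf; rewrite !ltW.
- by apply: within_cc_continuous => t /hf/is_derive1_continuous.
- by rewrite in_itv/= => abc ?; exists c.
Qed.

Lemma deriv_ge0_le f f' a b : a <= b ->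
  (forall t, a <= t <= b -> is_derive t 1 f (f' t)) ->
  (forall t, a <= t <= b -> 0 <= f' t) -> f a <= f b.
Proof.
move=> ab hf f'0; have [c /f'0 c0 e] := deriv_mvt ab hf.
by rewrite -subr_ge0 e mulr_ge0// subr_ge0.
Qed.

Lemma deriv_lip f f' C a b : a <= b ->
  (forall t, a <= t <= b -> is_derive t 1 f (f' t)) ->
  (forall t, a <= t <= b -> `|f' t| <= C) -> `|f b - f a| <= C * (b - a).
Proof.
move=> ab hf f'C; have [c /f'C cC e] := deriv_mvt ab hf.
by rewrite e normrM (ger0_norm (_ : 0 <= b - a)) ?subr_ge0// ler_wpM2r// subr_ge0.
Qed.

Lemma lip_continuous f C : (forall s t, `|f s - f t| <= C * `|s - t|) ->
  continuous f.
Proof.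
move=> hf t; apply/cvgrPdist_le => /= e e0.
have C0 : 0 < `|C| + 1 by rewrite ltr_wpDl.
near=> s; apply: (le_trans (hf _ _)).
apply: (@le_trans _ _ ((`|C| + 1) * `|t - s|)).
  by rewrite ler_wpM2r// (le_trans (ler_norm C))// lerDl.
rewrite mulrC -ler_pdivlMr//.
by near: s; apply: cvgr_dist_le => //; rewrite divr_gt0.
Unshelve. all: by end_near. Qed.

Lemma deriv_has_deriv_within (J : set R) f t l : is_derive t 1 f l ->
  has_deriv_within J f t l.
Proof.
move=> /is_derive1_caratheodory[g [gE cg <-]].
have cgJ : g s @[s --> within J t^'] --> g t.
  apply: cvg_trans cg; apply: cvg_fmap2.
  by apply: (cvg_trans (cvg_within J)); exact: cvg_within.
rewrite /has_deriv_within; apply: cvg_trans cgJ; apply: near_eq_cvg.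
near=> s; rewrite gE mulfK// subr_eq0.
by near: s; exact: (cvg_within J (nbhs_dnbhs_neq t)).
Unshelve. all: by end_near. Qed.

Lemma quot_is_derive f t l :
  (f s - f t) / (s - t) @[s --> t^'] --> l -> is_derive t 1 f l.
Proof.
move=> hl; apply/is_derive1_caratheodory.
exists (fun s => if s == t then l else (f s - f t) / (s - t)); split.
- move=> s; case: eqP => [->|/eqP st]; first by rewrite !subrr mulr0.
  by rewrite divfK// subr_eq0.
- apply/continuous_withinNx; rewrite eqxx.
  apply: cvg_trans hl; apply: near_eq_cvg; near=> s.
  by rewrite ifN//; near: s; exact: nbhs_dnbhs_neq.
- by rewrite eqxx.
Unshelve. all: by end_near. Qed.

Lemma near_lt_ereal t (T : \bar R) : (t%:E < T)%E ->
  \forall s \near t, (s%:E < T)%E.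
Proof.
case: T => [r||//]; rewrite ?lte_fin => tr.
  by near=> s; rewrite lte_fin; near: s; exact: lt_nbhsl.
by near=> s; rewrite ltry.
Unshelve. all: by end_near. Qed.

(* Extending by the tangent line to the left of 0 makes the one-sided
   derivative at 0 two-sided. *)
Lemma tangent_extension (T : \bar R) f f' :
  (forall t, 0 <= t -> (t%:E < T)%E ->
     has_deriv_within [set s : R | 0 <= s /\ (s%:E < T)%E] f t (f' t)) ->
  forall t, 0 <= t -> (t%:E < T)%E ->
    is_derive t 1 (fun s => if s < 0 then f 0 + s * f' 0 else f s) (f' t).
Proof.
move=> hf t t0 tT; apply: quot_is_derive.
have tN0 : (t < 0) = false by rewrite ltNge t0.
rewrite /= tN0.
apply/cvgrPdist_le => /= e e0.
have /cvgrPdist_le/(_ e e0) := hf t t0 tT; rewrite near_withinE => He.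
have tT' : \forall s \near t^', (s%:E < T)%E.
  exact: (cvg_within _ (near_lt_ereal tT)).
have HT : \forall s \near t^', 0 <= s ->
    `|f' t - (f s - f t) / (s - t)| <= e.
  by apply: filterS2 He tT' => s + sT s0; apply.
move: t0; rewrite le_eqVlt => /predU1P[t0|t0].
  subst t; near=> s; case: ifPn => [s0|]; last first.
    by rewrite -leNgt; near: s; exact: HT.
  rewrite subr0 addrAC subrr add0r mulrC mulKf ?subrr ?normr0 ?ltW//.
  by rewrite lt_eqF.
have t0' : \forall s \near t^', 0 < s by apply: (cvg_within _ (lt_nbhsr t0)).
near=> s.
have s0 : 0 < s by near: s.
rewrite ltNge (ltW s0)/=.
by move/ltW: s0; near: s; exact: HT.
Unshelve. all: by end_near. Qed.

(** On a window of length d = e / (2C) the function q varies by at most e / 2. If h moves by at most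
    e d / 2 over that window, the mean value theorem yields a point where |q| <= e / 2, hence |q| <=
    e at its left end. Asking for h to be Cauchy covers both the monotone energy and the convergent
    coordinates. *)
Lemma barbalat h q C :
  (forall t, 0 <= t -> is_derive t 1 h (q t)) ->
  (forall s t, 0 <= s -> s <= t -> `|q s - q t| <= C * (t - s)) ->
  (forall e, 0 < e -> exists2 N, 0 <= N &
     forall t, N <= t -> `|h t - h N| <= e) ->
  q t @[t --> +oo] --> 0.
Proof.
move=> hq; wlog C0 : C / 0 < C => [wl hC|hC] hh.
  apply: (wl (`|C| + 1)) => // s t s0 st.
  apply: (le_trans (hC _ _ s0 st)); rewrite ler_wpM2r ?subr_ge0//.
  by rewrite (le_trans (ler_norm C))// lerDl.
apply/cvgrPdist_le => /= e e0; pose d := e / (2 * C).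
have d0 : 0 < d by rewrite divr_gt0// mulr_gt0.
have [|N N0 hN] := hh (e * d / 4); first by rewrite divr_gt0// mulr_gt0.
near=> t; have Nt : N <= t by near: t; apply: nbhs_pinfty_ge; exact: num_real.
have t0 := le_trans N0 Nt; rewrite sub0r normrN.
have ttd : t <= t + d by rewrite lerDl ltW.
have [|c /andP[tc ctd] hc] := deriv_mvt ttd (f' := q) (f := h).
  by move=> s /andP[ts _]; apply: hq; exact: le_trans ts.
have h1 : `|q c| * d <= e / 2 * d.
  have -> : `|q c| * d = `|(h (t + d) - h N) - (h t - h N)|.
    rewrite -[X in _ * X](gtr0_norm d0) -normrM; congr `|_|; move: hc; lra.
  apply: (le_trans (ler_normB _ _)).
  have := hN _ (le_trans Nt ttd); have := hN _ Nt; lra.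
rewrite ler_pM2r// in h1.
have := hC _ _ t0 tc.
have : C * (c - t) <= e / 2.
  apply: (@le_trans _ _ (C * d)); first by rewrite ler_pM2l//; lra.
  by rewrite /d le_eqVlt; apply/orP; left; apply/eqP; field; rewrite gt_eqF.
have := ler_normD (q t - q c) (q c); rewrite subrK; lra.
Unshelve. all: by end_near. Qed.

Lemma continuous_bounded_cc g a b :
  (forall x, a <= x <= b -> {for x, continuous g}) ->
  exists2 C, 0 <= C & forall x, a <= x <= b -> `|g x| <= C.
Proof.
move=> cg; have [ab|ba] := leP a b; last first.
  by exists 0 => // x /andP[ax xb]; move: (le_trans ax xb); rewrite leNgt ba.
have [|c _ hc] := @EVT_max R (fun x => `|g x|) a b ab.
  apply: within_cc_continuous => x /cg cgx.
  exact: (continuous_comp cgx (@norm_continuous _ _ _)).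
by exists `|g c| => // x xab; apply: hc; rewrite in_itv.
Qed.

Lemma C1_lipschitz_cc g a b :
  (forall x, a <= x <= b -> derivable g x 1) ->
  (forall x, a <= x <= b -> {for x, continuous (derive1 g)}) ->
  exists2 C, 0 <= C & forall x y, a <= x <= b -> a <= y <= b ->
    `|g x - g y| <= C * `|x - y|.
Proof.
move=> dg cg; have [C C0 hC] := continuous_bounded_cc cg.
exists C => // x y; wlog xy : x y / x <= y => [wl xab yab|].
  have [xy|/ltW yx] := leP x y; first exact: wl.
  by rewrite distrC (distrC x); exact: wl.
move=> /andP[ax xb] /andP[ay yb];
rewrite distrC (distrC x) (ger0_norm (_ : 0 <= y - x)) ?subr_ge0//.
apply: (deriv_lip xy (f' := derive1 g)) => t /andP[xt ty].
  by apply/derivable1_deriv/dg; rewrite (le_trans ax xt) (le_trans ty yb).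
by apply: hC; rewrite (le_trans ax xt) (le_trans ty yb).
Qed.

Lemma antiderivative h : continuous h ->
  exists P : R -> R, P 0 = 0 /\ forall t, 0 <= t -> is_derive t 1 P (h t).
Proof.
move=> ch.
(* Starting the integral at -1 makes every t >= 0, including 0, an interior point, so that the
   derivative is two-sided there. *)
pose Q x := (\int[lebesgue_measure]_(s in [set` Interval (BLeft (-1)) (BRight x)]) h s)%R.
exists (fun t => Q t - Q 0); split; first by rewrite subrr.
move=> t t0.
have tt1 : t < t + 1 by rewrite ltrDl.
have := @continuous_FTC1 R h (BLeft (-1)) t (t + 1) tt1.
case=> [||//|dQ Q't]; last 2 first.
- exact: ch.
- apply: (@is_derive1_eq _ _ (h t - 0)); last by rewrite subr0.
  apply: is_derive1B (is_derive1_cst (Q 0) t).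
  by rewrite -Q't; exact: derivable1_deriv.
- apply: continuous_compact_integrable; first exact: segment_compact.
  exact: continuous_subspaceT.
- by rewrite /Order.lt/=; lra.
Qed.

Lemma maxr_lip (c s t : R) : `|Num.max s c - Num.max t c| <= `|s - t|.
Proof.
wlog st : s t / s <= t => [wl|].
  by have [/wl//|/ltW/wl] := leP s t; rewrite distrC (distrC t).
rewrite distrC (distrC s) (ger0_norm (_ : 0 <= t - s)) ?subr_ge0//.
by rewrite ler_norml /Num.max; case: (ltP s c); case: (ltP t c); lra.
Qed.

Lemma minr_lip (c s t : R) : `|Num.min s c - Num.min t c| <= `|s - t|.
Proof.
wlog st : s t / s <= t => [wl|].
  by have [/wl//|/ltW/wl] := leP s t; rewrite distrC (distrC t).
rewrite distrC (distrC s) (ger0_norm (_ : 0 <= t - s)) ?subr_ge0//.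
by rewrite ler_norml /Num.min; case: (ltP s c); case: (ltP t c); lra.
Qed.

Definition clamp (l u s : R) := Num.min (Num.max s l) u.

Lemma clamp_lip (l u s t : R) : `|clamp l u s - clamp l u t| <= `|s - t|.
Proof. exact: le_trans (minr_lip _ _ _) (maxr_lip l s t). Qed.

Lemma clamp_itv (l u s : R) : l <= u -> l <= clamp l u s <= u.
Proof. by move=> lu; rewrite /clamp le_min le_max lexx orbT lu ge_min lexx orbT. Qed.

Lemma clamp_id (l u s : R) : l <= s <= u -> clamp l u s = s.
Proof. by move=> /andP[ls su]; rewrite /clamp (max_idPl ls) (min_idPl su). Qed.

(** Integrating factor e^(k t). This is the barrier argument for the speeds: q is the distance to an
    end of the allowed interval, and it may decay but not change sign. *)
Lemma ge0_of_deriv_ge (q q' : R -> R) (k b : R) : 0 <= b ->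
  (forall t, 0 <= t <= b -> is_derive t 1 q (q' t)) ->
  (forall t, 0 <= t <= b -> - (k * q t) <= q' t) -> 0 <= q 0 -> 0 <= q b.
Proof.
move=> b0 dq hq q0.
have d s : 0 <= s <= b -> is_derive s 1 (fun s => expR (k * s) * q s)
    (expR (k * s) * (k * 1) * q s + expR (k * s) * q' s).
  move=> sb; exact: is_derive1M (is_derive1_compose (is_derive_expR _)
    (is_derive1Z k (is_derive1_id s))) (dq s sb).
have := deriv_ge0_le b0 d; rewrite mulr0 expR0 mul1r => h.
have {}h : q 0 <= expR (k * b) * q b.
  apply: h => s /hq; rewrite -(ler_pM2l (expR_gt0 (k * s))).
  by set E := expR _; lra.
by have := le_trans q0 h; rewrite pmulr_rge0// expR_gt0.
Qed.

Lemma nonincreasing_cauchy h : (forall s t, 0 <= s -> s <= t -> h t <= h s) ->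
  (forall t, 0 <= t -> 0 <= h t) ->
  forall e, 0 < e -> exists2 N, 0 <= N & forall t, N <= t -> `|h t - h N| <= e.
Proof.
move=> hd h0 e e0; pose E := [set h t | t in [set t | 0 <= t]].
have infE : has_inf E.
  by split; [exists (h 0), 0 => /=|exists 0 => _ [t /= t0 <-]; exact: h0].
have [_ [N /= N0 <-] hN] := inf_adherent e0 infE.
exists N => // t Nt; have t0 := le_trans N0 Nt.
have : inf E <= h t by apply: ge_inf; [exact: infE.2|exists t].
have := hd _ _ N0 Nt; rewrite ler_norml; lra.
Qed.

Lemma cvg_pinfty_cauchy h l : h t @[t --> +oo] --> l ->
  forall e, 0 < e -> exists2 N, 0 <= N & forall t, N <= t -> `|h t - h N| <= e.
Proof.
move=> /cvgrPdist_le hl e e0.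
have [|N [_ hN]] := hl (e / 2); first by rewrite divr_gt0.
have mN : N <= Num.max N 0 by rewrite le_max lexx.
(* Neighbourhoods of +oo are given by strict inequalities, hence the shift by 1. *)
exists (Num.max N 0 + 1) => [|t Nt].
  by rewrite addr_ge0// le_max lexx orbT.
have h1 := hN t; have h2 := hN (Num.max N 0 + 1).
have {}h1 : `|l - h t| <= e / 2 by apply: h1; lra.
have {}h2 : `|l - h (Num.max N 0 + 1)| <= e / 2 by apply: h2; lra.
by move: h1 h2; rewrite !ler_norml; lra.
Qed.

End Calculus.

(** * Global solutions of Lipschitz differential equations *)

Section ODE.
Context {R : realType} {I : finType}.
Implicit Types (z : I -> R) (G : (I -> R) -> I -> R).

Definition l1dist z z' : R := \sum_k `|z k - z' k|.

Lemma l1dist_ge0 z z' : 0 <= l1dist z z'.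
Proof. exact: sumr_ge0. Qed.

Lemma coord_le_l1dist z z' k : `|z k - z' k| <= l1dist z z'.
Proof. by rewrite /l1dist (bigD1 k)//= lerDl sumr_ge0. Qed.

Lemma l1dist_le z z' (e : R) : (forall k, `|z k - z' k| <= e) ->
  l1dist z z' <= #|I|%:R * e.
Proof.
move=> h; apply: (le_trans (ler_sum _ (fun k _ => h k))).
by rewrite sumr_const cardT -cardE mulr_natl.
Qed.

Lemma geometric_small (c e : R) : 0 < e -> exists k, c / 2 ^+ k <= e.
Proof.
move=> e0; pose k := Num.truncn (c / e); exists k.
rewrite ler_pdivrMr ?exprn_gt0// -ler_pdivrMl//.
have : c / e < 2 ^+ k.
  apply: (@lt_le_trans _ _ (k.+1)%:R); first exact: truncnS_gt.
  by rewrite -natrX ler_nat ltn_expl.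
by rewrite mulrC => /ltW.
Qed.

Lemma le_geometric_error (x y c : R) : (forall k, x <= y + c / 2 ^+ k) -> x <= y.
Proof.
move=> h; apply/ler_addgt0Pr => e e0.
by have [k hk] := geometric_small c e0; rewrite (le_trans (h k))// lerD2l.
Qed.

(** The intervals around [u k] of radius 2B / 2^k, the sum of the tail of the increments, are
    nested; the limit is the supremum of their left ends. The explicit rate replaces completeness of
    a function space in the Picard iteration. *)
Lemma geometric_limit (u : nat -> R) (B : R) :
  (forall k, `|u k.+1 - u k| <= B / 2 ^+ k) ->
  exists l, forall k, `|u k - l| <= 2 * B / 2 ^+ k.
Proof.
move=> hu; pose lo k := u k - 2 * B / 2 ^+ k; pose up k := u k + 2 * B / 2 ^+ k.
have half k : 2 * B / 2 ^+ k.+1 = B / 2 ^+ k.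
  by rewrite exprS; field; rewrite ?expf_neq0.
have twice k : 2 * B / 2 ^+ k = B / 2 ^+ k + B / 2 ^+ k by lra.
have B0 k : 0 <= B / 2 ^+ k := le_trans (normr_ge0 _) (hu k).
have lo1 k : lo k <= lo k.+1.
  have := hu k; rewrite /lo half twice ler_norml; lra.
have up1 k : up k.+1 <= up k.
  have := hu k; rewrite /up half twice ler_norml; lra.
have lo_homo : {homo lo : i j / (i <= j)%N >-> i <= j}.
  exact: homo_leq (@lexx _ _) (fun _ _ _ => @le_trans _ _ _ _ _) lo1.
have up_homo i j : (i <= j)%N -> up j <= up i.
  apply: (homo_leq (f := up) (r := fun x y => y <= x) _ _ up1) => // y x w xy yw.
  exact: le_trans yw xy.
have loup i j : lo i <= up j.
  apply: (le_trans (lo_homo _ _ (leq_maxl i j))).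
  apply: (le_trans _ (up_homo _ _ (leq_maxr i j))).
  by rewrite /lo /up twice; have := B0 (maxn i j); lra.
exists (sup (range lo)) => k.
have ub : has_ubound (range lo) by exists (up 0%N) => _ [i _ <-].
have h1 : lo k <= sup (range lo) by apply: ub_le_sup => //; exists k.
have h2 : sup (range lo) <= up k by apply: ge_sup; [exists (lo k), k|move=> _ [i _ <-]].
by move: h1 h2; rewrite /lo /up ler_norml; lra.
Qed.

Lemma deriv_comparison (D D' E E' : R -> R) (t : R) : 0 <= t -> D 0 = 0 ->
  0 <= E 0 ->
  (forall s, 0 <= s <= t -> is_derive s 1 D (D' s)) ->
  (forall s, 0 <= s <= t -> is_derive s 1 E (E' s)) ->
  (forall s, 0 <= s <= t -> `|D' s| <= E' s) -> `|D t| <= E t.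
Proof.
move=> t0 D0 E0 dD dE DE; rewrite ler_norml.
have h1 := deriv_ge0_le t0 (fun s st => is_derive1B (dE s st) (dD s st)).
have h2 := deriv_ge0_le t0 (fun s st => is_derive1D (dE s st) (dD s st)).
have {}h1 : E 0 - D 0 <= E t - D t.
  by apply: h1 => s /DE; rewrite ler_norml; lra.
have {}h2 : E 0 + D 0 <= E t + D t.
  by apply: h2 => s /DE; rewrite ler_norml; lra.
by move: h1 h2; rewrite D0; lra.
Qed.

(** * Picard iteration on [0, +oo) for a bounded Lipschitz field *)

Section Picard.
Context (G : (I -> R) -> I -> R) (M C : R) (z0 : I -> R).
Hypothesis GM : forall z i, `|G z i| <= M.
Hypothesis GC : forall z z' i, `|G z i - G z' i| <= C * l1dist z z'.

(** The invariant of the iteration: M-Lipschitz in time. It makes the next integrand continuous, and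
    it passes to pointwise limits. *)
Let admissible (z : R -> I -> R) := forall (s t : R) i, 0 <= s -> s <= t ->
  `|z t i - z s i| <= M * (t - s).

(* An antiderivative on [0, +oo) vanishing at 0; the integrands below are
   composed with [Num.max ^~ 0] to be continuous on all of R. *)
Let prim (h : R -> R) : R -> R :=
  xget (fun=> 0) [set P : R -> R | P 0 = 0 /\ forall t : R, 0 <= t -> is_derive t 1 P (h t)].

Let step (z : R -> I -> R) : R -> I -> R := fun t i =>
  z0 i + prim (fun s => G (z (Num.max s 0)) i) t.

Let prim_spec (z : R -> I -> R) i : admissible z ->
  prim (fun s => G (z (Num.max s 0)) i) 0 = 0 /\
  forall t : R, 0 <= t ->
    is_derive t 1 (prim (fun s => G (z (Num.max s 0)) i)) (G (z t) i).
Proof.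
move=> zM; pose h s := G (z (Num.max s 0)) i.
have zl s t : 0 <= s -> 0 <= t -> forall k, `|z s k - z t k| <= M * `|s - t|.
  move=> s0 t0 k; have [st|ts] := leP s t.
    by rewrite distrC (distrC s) [`|t - s|]ger0_norm ?subr_ge0// zM.
  by rewrite [`|s - t|]gtr0_norm ?subr_gt0// zM// ltW.
have ch : continuous h.
  have C0 := le_trans (normr_ge0 _) (GC z0 (fun k => z0 k + 1) i).
  apply: (@lip_continuous _ _ (`|C| * (#|I|%:R * M))) => s t.
  apply: (le_trans (GC _ _ i)).
  apply: (@le_trans _ _ (`|C| * l1dist (z (Num.max s 0)) (z (Num.max t 0)))).
    by rewrite ler_wpM2r ?l1dist_ge0 ?ler_norm.
  rewrite -!mulrA ler_wpM2l//; apply: l1dist_le => k.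
  apply: (le_trans (zl _ _ _ _ k)); rewrite ?le_max ?lexx ?orbT//.
  rewrite ler_wpM2l ?(le_trans (normr_ge0 _) (GM z0 i))//.
  exact: maxr_lip.
have [P hP] := antiderivative ch.
have [P0 dP] := @xgetPex _ (fun=> 0)
  [set P : R -> R | P 0 = 0 /\ forall t : R, 0 <= t -> is_derive t 1 P (h t)] (ex_intro _ P hP).
split=> // t t0; apply: is_derive1_eq (dP t t0) _.
by rewrite /h (max_idPl t0).
Qed.

Let step0 (z : R -> I -> R) i : admissible z -> step z 0 i = z0 i.
Proof. by move=> /(@prim_spec _ i)[h _]; rewrite /step h addr0. Qed.

Let step_deriv (z : R -> I -> R) i (t : R) : admissible z -> 0 <= t ->
  is_derive t 1 (fun s => step z s i) (G (z t) i).
Proof.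
move=> /(@prim_spec _ i)[_ h] t0.
by apply: is_derive1_eq (is_derive1D (is_derive1_cst (z0 i) t) (h t t0)) _; rewrite add0r.
Qed.

Let step_admissible (z : R -> I -> R) : admissible z -> admissible (step z).
Proof.
move=> zM s t i s0 st; apply: (@deriv_lip _ (fun r => step z r i) (fun r => G (z r) i) M s t st).
  by move=> r /andP[sr _]; apply: step_deriv => //; exact: le_trans sr.
by move=> r _; exact: GM.
Qed.

(** The weight e^(K t) satisfies C |I| e^(K s) <= (1/2) (e^(K s))', which is the contraction by 1/2;
    the summand 1 gives t <= e^(K t), which bounds the first increment M t. *)
Let K := 2 * (C * #|I|%:R) + 1.

Let step_contract (z z' : R -> I -> R) B : 0 <= B -> 0 <= C ->
  admissible z -> admissible z' ->
  (forall t i, 0 <= t -> `|z t i - z' t i| <= B * expR (K * t)) ->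
  forall t i, 0 <= t -> `|step z t i - step z' t i| <= B / 2 * expR (K * t).
Proof.
move=> B0 C0 za z'a zz' t i t0.
apply: (@deriv_comparison (fun t => step z t i - step z' t i)
  (fun t => G (z t) i - G (z' t) i) (fun t => B / 2 * expR (K * t))
  (fun t => B / 2 * (expR (K * t) * (K * 1)))) => //.
- by rewrite !step0// subrr.
- by rewrite mulr_ge0 ?expR_ge0// divr_ge0.
- by move=> s /andP[s0 _]; apply: is_derive1B; exact: step_deriv.
- move=> s /andP[s0 _]; apply: (le_trans (GC _ _ _)).
  apply: (@le_trans _ _ (C * (#|I|%:R * (B * expR (K * s))))).
    by rewrite ler_wpM2l//; apply: l1dist_le => k; exact: zz'.
  have := mulr_ge0 B0 (expR_ge0 (K * s)); set E := expR _.
  by rewrite /K; lra.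
Qed.

(* The iterates are compared in the weighted norm sup_t e^(- K t) |z t|, in which
   one step halves the distance. *)
Lemma picard_lindelof : exists z : R -> I -> R,
  (forall i, z 0 i = z0 i) /\
  forall i (t : R), 0 <= t -> is_derive t 1 (fun s => z s i) (G (z t) i).
Proof.
(* The sign of C is read off from two points at positive distance, which exist only when I is
   inhabited. *)
have [noI|/card_gt0P[i0 _]] := posnP #|I|.
  exists (fun=> z0); split => // i; have : i \in I by [].
  by move/card0_eq : noI => ->.
have M0 := le_trans (normr_ge0 _) (GM z0 i0).
have C0 : 0 <= C.
  have := GC z0 (fun k => z0 k + 1) i0.
  move/(le_trans (normr_ge0 _)); rewrite pmulr_lge0//.
  by apply: lt_le_trans (coord_le_l1dist _ _ i0); rewrite normr_gt0; lra.
pose it k := iter k step (fun=> z0).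
have it_adm k : admissible (it k).
  elim: k => [|k ih]; last exact: step_admissible.
  by move=> s t i s0 st; rewrite /= subrr normr0 mulr_ge0// subr_ge0.
have it_close k t i : 0 <= t ->
    `|it k.+1 t i - it k t i| <= M / 2 ^+ k * expR (K * t).
  elim: k t i => [|k ih] t i t0.
    have := step_admissible (it_adm 0%N) i (lexx 0) t0.
    rewrite subr0 (step0 i (it_adm 0%N))/= expr0 divr1 => /le_trans; apply.
    rewrite ler_wpM2l//; apply: (le_trans _ (expR_ge1Dx _)).
    by rewrite /K; have := mulr_ge0 (mulr_ge0 C0 (ler0n R #|I|)) t0; lra.
  rewrite exprS invfM mulrA (mulrAC M).
  by apply: step_contract => //; [rewrite divr_ge0|exact: (it_adm k.+1)].
have [z hz] : exists z : R -> I -> R, forall t i, 0 <= t ->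
    forall k, `|it k t i - z t i| <= 2 * (M * expR (K * t)) / 2 ^+ k.
  suff /choice[z hz] : forall t, exists zt : I -> R, forall i, 0 <= t ->
      forall k, `|it k t i - zt i| <= 2 * (M * expR (K * t)) / 2 ^+ k.
    by exists z; move=> s j; exact: hz.
  move=> t; suff /choice[zt hzt] : forall i, exists l, 0 <= t -> forall k,
      `|it k t i - l| <= 2 * (M * expR (K * t)) / 2 ^+ k by exists zt.
  move=> i.
  have [t0|_] := leP 0 t; last by exists 0.
  have [|l hl] := @geometric_limit (fun k => it k t i) (M * expR (K * t)).
    by move=> k; rewrite mulrAC; exact: it_close.
  by exists l.
have z_adm : admissible z.
  move=> s t i s0 st; have t0 := le_trans s0 st.
  apply: (@le_geometric_error _ _
    (2 * (M * expR (K * t)) + 2 * (M * expR (K * s)))) => k.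
  have := it_adm k s t i s0 st; have := hz t i t0 k; have := hz s i s0 k.
  rewrite (mulrDl _ _ (_ ^-1)) !ler_norml; lra.
(* Both [z] and [step z] are within a multiple of 2^-k of the iterate of rank k + 1: the former by
   construction, the latter by contraction from rank k. *)
have z_fix t i : 0 <= t -> step z t i = z t i.
  move=> t0; apply/eqP; rewrite -subr_eq0 -normr_le0.
  apply: (@le_geometric_error _ _ (4 * (M * expR (K * t)))) => k.
  have h1 := hz t i t0 k.+1.
  have B0 : 0 <= 2 * M / 2 ^+ k by rewrite divr_ge0// mulr_ge0.
  have h2 : `|it k.+1 t i - step z t i| <= (2 * M / 2 ^+ k) / 2 * expR (K * t).
    apply: step_contract => // s j s0.
    by apply: (le_trans (hz s j s0 k)); rewrite le_eqVlt; apply/orP; left;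
       apply/eqP; ring.
  have := mulr_ge0 B0 (expR_ge0 (K * t)).
  have e1 : 2 * (M * expR (K * t)) / 2 ^+ k.+1 =
            2 * M / 2 ^+ k * expR (K * t) / 2.
    by rewrite exprS; field; rewrite ?expf_neq0.
  have e2 : 4 * (M * expR (K * t)) / 2 ^+ k =
            2 * (2 * M / 2 ^+ k * expR (K * t)) by ring.
  move: h1 h2; rewrite e1 e2 add0r !ler_norml.
  set E := 2 * M / 2 ^+ k; set X := expR _; lra.
exists (step z); split => [i|i t t0]; first exact: step0.
have -> : step z t = z t by apply/funext => j; exact: z_fix.
exact: step_deriv.
Qed.

End Picard.

(** Gronwall's argument for the squared Euclidean distance D, which is differentiable while the l1
    distance is not. Expanding the l1 distance and using 2 a b <= a^2 + b^2 gives D' <= 2 C |I| D,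
    so e^(- K t) D decreases from 0. *)
Lemma ode_unique G (C b : R) (z z' : R -> I -> R) :
  (forall x y i, `|G x i - G y i| <= C * l1dist x y) ->
  (forall i, z 0 i = z' 0 i) ->
  (forall i (t : R), 0 <= t <= b -> is_derive t 1 (fun s => z s i) (G (z t) i)) ->
  (forall i (t : R), 0 <= t <= b -> is_derive t 1 (fun s => z' s i) (G (z' t) i)) ->
  forall t i, 0 <= t <= b -> z t i = z' t i.
Proof.
move=> GC z0 dz dz' t i /andP[t0 tb].
have C0 : 0 <= C.
  have := GC (z 0) (fun k => z 0 k + 1) i.
  move/(le_trans (normr_ge0 _)); rewrite pmulr_lge0//.
  by apply: lt_le_trans (coord_le_l1dist _ _ i); rewrite normr_gt0; lra.
pose D s := \sum_k (z s k - z' s k) ^+ 2.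
pose D' s := \sum_k 2 * (z s k - z' s k) * (G (z s) k - G (z' s) k).
pose K := 2 * C * #|I|%:R.
have dD s : 0 <= s <= t -> is_derive s 1 D (D' s).
  move=> /andP[s0 st]; apply: is_derive1_sum => k _; apply: is_derive1_sqr.
  by apply: is_derive1B; [apply: dz|apply: dz']; rewrite s0 (le_trans st).
have D'K s : D' s <= K * D s.
  pose a k := `|z s k - z' s k|.
  have aa k : (z s k - z' s k) ^+ 2 = a k ^+ 2 by rewrite /a real_normK ?num_real.
  apply: (@le_trans _ _ (\sum_k \sum_j C * (a k ^+ 2 + a j ^+ 2))).
    apply: ler_sum => k _; apply: (le_trans (ler_norm _)).
    rewrite !normrM (ger0_norm (_ : 0 <= 2 :> R))// -/(a k).
    apply: (@le_trans _ _ (2 * a k * (C * l1dist (z s) (z' s)))).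
      by rewrite ler_wpM2l ?GC// mulr_ge0// /a.
    rewrite /l1dist mulr_sumr mulr_sumr; apply: ler_sum => j _; rewrite -/(a j).
    have := mulr_ge0 C0 (sqr_ge0 (a k - a j)); lra.
  under eq_bigr do rewrite -mulr_sumr big_split/= sumr_const.
  rewrite -mulr_sumr big_split/= sumr_const -/(D s) /K /D.
  under [X in _ <= _ * X]eq_bigr do rewrite aa.
  by rewrite sumrMnl cardT -cardE -mulrnDl -[in leLHS]mulr_natl
    le_eqVlt; apply/orP; left; apply/eqP; ring.
have dE s : 0 <= s <= t -> is_derive s 1 (fun s => - (expR (- K * s) * D s))
    (- (expR (- K * s) * (- K * 1) * D s + expR (- K * s) * D' s)).
  move=> st; apply: is_derive1N.
  exact: is_derive1M (is_derive1_compose (is_derive_expR _)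
    (is_derive1Z (- K) (is_derive1_id s))) (dD s st).
have := deriv_ge0_le t0 dE.
have D0 : D 0 = 0 by rewrite /D big1// => k _; rewrite z0 subrr expr0n.
rewrite D0 mulr0 oppr0 => h.
have {}h : 0 <= - (expR (- K * t) * D t).
  apply: h => s _; have := mulr_ge0 (expR_ge0 (- K * s)) (_ : 0 <= K * D s - D' s).
  by rewrite subr_ge0 D'K => /(_ isT); set X := expR _; lra.
have Dt : D t = 0.
  apply/eqP; rewrite eq_le sumr_ge0 ?andbT => [|k _]; last exact: sqr_ge0.
  by move: h; rewrite oppr_ge0 pmulr_rle0 ?expR_gt0.
move/eqP: Dt; rewrite psumr_eq0 => [/allP/(_ i)|k _]; last exact: sqr_ge0.
by rewrite mem_index_enum sqrf_eq0 subr_eq0 => /(_ isT)/eqP.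
Qed.

End ODE.

Lemma maximum_spec d (T : porderType d) (x0 : T) (A : set T) :
  (exists x, (A `&` ubound A) x) -> (A `&` ubound A) (maximum x0 A).
Proof. exact: xgetPex. Qed.

(** * Maxima, elliptic norms and packings *)

Section Geometry.
Context {R : realType}.
Implicit Types (p L lambda : R) (z : R * R).

(** The extreme value theorem makes the maximum attained, so [maximum] does not fall back on its
    default. The set is kept abstract because it is given by |y| <= s in some uses. *)
Lemma le_maximum_image (A : set R) (g : R -> R) (a b x : R) :
  A = [set y | a <= y <= b] ->
  (forall y, a <= y <= b -> {for y, continuous g}) ->
  A x -> g x <= maximum 0 [set g y | y in A].
Proof.
move=> -> cg axb; have ab : a <= b by case/andP: axb; exact: le_trans.
have [c] := EVT_max ab (within_cc_continuous cg).
rewrite in_itv/= => cab hc.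
suff /(maximum_spec 0)[_ ub] : exists m : R,
    ([set g y | y in [set y | a <= y <= b]] `&`
     ubound [set g y | y in [set y | a <= y <= b]]) m.
  by apply: ub; exists x.
exists (g c); split; first by exists c.
by move=> _ [y yab <-]; apply: hc; rewrite in_itv.
Qed.

Lemma enorm_ge0 p z : 0 <= enorm p z.
Proof. exact: sqrtr_ge0. Qed.

Lemma enorm_sqr p z : 0 <= p -> enorm p z ^+ 2 = z.1 ^+ 2 + p * z.2 ^+ 2.
Proof. by move=> p0; rewrite sqr_sqrtr// addr_ge0 ?sqr_ge0// mulr_ge0 ?sqr_ge0. Qed.

Lemma norm_fst_le_enorm p z : 0 <= p -> `|z.1| <= enorm p z.
Proof.
move=> p0; rewrite -ler_sqr ?nnegrE ?enorm_ge0// enorm_sqr// real_normK ?num_real//.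
by rewrite lerDl mulr_ge0 ?sqr_ge0.
Qed.

Lemma norm_snd_le_enorm p z : 0 <= p -> Num.sqrt p * `|z.2| <= enorm p z.
Proof.
move=> p0; rewrite -ler_sqr ?nnegrE ?enorm_ge0 ?mulr_ge0 ?sqrtr_ge0//.
rewrite enorm_sqr// exprMn sqr_sqrtr// real_normK ?num_real//.
by rewrite lerDr sqr_ge0.
Qed.

Lemma enorm_le p z : 0 <= p -> enorm p z <= `|z.1| + Num.sqrt p * `|z.2|.
Proof.
move=> p0; have h : 0 <= `|z.1| * (Num.sqrt p * `|z.2|).
  by rewrite !mulr_ge0// sqrtr_ge0.
rewrite -ler_sqr ?nnegrE ?enorm_ge0 ?addr_ge0 ?mulr_ge0 ?sqrtr_ge0//.
rewrite enorm_sqr// sqrrD exprMn sqr_sqrtr// !real_normK ?num_real//; lra.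
Qed.

(** Multiplying by the sum of the two norms turns the left side into a difference of squares, which
    factors coordinate by coordinate; each factor is then dominated by the sum of the norms. *)
Lemma enorm_lip p z z' : 0 <= p ->
  `|enorm p z - enorm p z'| <= `|z.1 - z'.1| + Num.sqrt p * `|z.2 - z'.2|.
Proof.
move=> p0; have [s0|] := ltP 0 (enorm p z + enorm p z'); last first.
  have := enorm_ge0 p z; have := enorm_ge0 p z' => h1 h2 h3.
  have [-> ->] : enorm p z = 0 /\ enorm p z' = 0 by split; lra.
  by rewrite subrr normr0 addr_ge0// mulr_ge0// sqrtr_ge0.
rewrite -(ler_pM2r s0) -[X in _ * X <= _](gtr0_norm s0) -normrM.
rewrite -subr_sqr !enorm_sqr//.
have -> : z.1 ^+ 2 + p * z.2 ^+ 2 - (z'.1 ^+ 2 + p * z'.2 ^+ 2) =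
  (z.1 - z'.1) * (z.1 + z'.1) +
  (Num.sqrt p * (z.2 - z'.2)) * (Num.sqrt p * (z.2 + z'.2)).
  by rewrite -[in LHS](sqr_sqrtr p0); ring.
apply: (le_trans (ler_normD _ _)); rewrite [leRHS]mulrDl lerD//.
  rewrite normrM ler_wpM2l//; apply: (le_trans (ler_normD _ _)).
  by rewrite lerD// norm_fst_le_enorm.
rewrite normrM; have sp := sqrtr_ge0 p.
rewrite !normrM (ger0_norm sp) ler_wpM2l ?mulr_ge0//.
apply: (@le_trans _ _ (Num.sqrt p * (`|z.2| + `|z'.2|))).
  by rewrite ler_wpM2l// ler_normD.
by rewrite mulrDr lerD// norm_snd_le_enorm.
Qed.

(* In the coordinates (x, sqrt p * y), two points of a grid cell of side L / 2 are
   less than L apart. *)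
Lemma packing_bounded p L lambda : 0 <= p -> 0 < L ->
  exists N : nat, forall k, packing p L lambda k -> (k <= N)%N.
Proof.
move=> p0 L0; pose l := `|lambda|; pose B := Num.truncn (4 * l / L).
pose cell (x : R) := Num.truncn (2 * (x + l) / L).
exists #|{: 'I_B.+1 * 'I_B.+1}| => k [q [uq <- ann sep]].
pose g (z : R * R) : 'I_B.+1 * 'I_B.+1 :=
  (inord (cell z.1), inord (cell (Num.sqrt p * z.2))).
have enl z : z \in q -> enorm p z <= l.
  move=> /ann/andP[_ h].
  by rewrite -ler_sqr ?nnegrE ?enorm_ge0 ?normr_ge0// enorm_sqr// real_normK ?num_real.
have cell_lt x : `|x| <= l -> 0 <= 2 * (x + l) / L /\ (cell x < B.+1)%N.
  rewrite ler_norml => /andP[h1 h2]; split.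
    by rewrite divr_ge0 ?(ltW L0)//; lra.
  rewrite ltnS truncn_le_nat; apply: le_lt_trans (truncnS_gt (4 * l / L)).
  by rewrite ler_pM2r ?invr_gt0//; lra.
have same x y : `|x| <= l -> `|y| <= l -> inord (cell x) = inord (cell y) :> 'I_B.+1 ->
    `|x - y| < L / 2.
  move=> /cell_lt[x0 xB] /cell_lt[y0 yB] /(congr1 (@nat_of_ord _)).
  rewrite !inordK// => e.
  have /andP[] := truncn_itv x0; have /andP[] := truncn_itv y0.
  rewrite -/(cell x) -/(cell y) e -[(cell y).+1%:R]natr1.
  set c := (cell y)%:R; rewrite ler_pdivlMr// ler_pdivlMr// ltr_pdivrMr// ltr_pdivrMr//.
  by rewrite ltr_norml; lra.
suff : (size (map g q) <= size (enum {: 'I_B.+1 * 'I_B.+1}))%N.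
  by rewrite size_map -cardE.
apply: uniq_leq_size => [|x _]; last by rewrite mem_enum.
rewrite map_inj_in_uniq// => z z' zq z'q [e1 e2]; apply/eqP; apply: contraT => zz'.
have b1 y : y \in q -> `|y.1| <= l.
  by move=> yq; apply: (le_trans (norm_fst_le_enorm _ p0)); exact: enl.
have b2 y : y \in q -> `|Num.sqrt p * y.2| <= l.
  move=> yq; apply: le_trans (enl y yq); rewrite normrM ger0_norm ?sqrtr_ge0//.
  exact: norm_snd_le_enorm.
have h1 := same _ _ (b1 z zq) (b1 z' z'q) e1.
have h2 := same _ _ (b2 z zq) (b2 z' z'q) e2.
have := sep z z' zq z'q zz'; have /= := @enorm_le p (z.1 - z'.1, z.2 - z'.2) p0.
move: h2; rewrite -mulrBr normrM (ger0_norm (sqrtr_ge0 p)); lra.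
Qed.

(** The bound on the size of packings makes the maximum exist; without it [max_packing] could be the
    default 0. *)
Lemma packing_le_max p L lambda k : 0 <= p -> 0 < L ->
  packing p L lambda k -> (k <= max_packing p L lambda)%N.
Proof.
move=> p0 L0 hk; have [N hN] := packing_bounded lambda p0 L0.
have exP : exists i, `[< packing p L lambda i >] by exists k; apply/asboolP.
have ubP i : `[< packing p L lambda i >] -> (i <= N)%N by move=> /asboolP/hN.
suff /(maximum_spec 0%N)[_] : exists i,
    ([set k | packing p L lambda k] `&`
     ubound [set k | packing p L lambda k]) i.
  by move=> /(_ _ hk); rewrite leEnat.
case: (ex_maxnP exP ubP) => i /asboolP hi imax; exists i; split => // j hj.
by rewrite leEnat; apply: imax; apply/asboolP.
Qed.

End Geometry.

(** * Bounded Lipschitz functions *)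

Section BoundedLipschitz.
Context {R : realType} {I : finType}.
Implicit Types (g h : (I -> R) -> R) (z : I -> R).

Definition lipschitz_fun g : Prop :=
  exists2 C, 0 <= C & forall z z', `|g z - g z'| <= C * l1dist z z'.

Definition bounded_fun g : Prop := exists2 M, 0 <= M & forall z, `|g z| <= M.

(** Lipschitz functions are not closed under products, bounded Lipschitz ones are. The class is thus
    stable under all the operations that build the feedback, including inverses of functions bounded
    away from 0. *)
Definition blip g : Prop := lipschitz_fun g /\ bounded_fun g.

Lemma lipschitz_coord k : lipschitz_fun (fun z => z k).
Proof. by exists 1 => // z z'; rewrite mul1r coord_le_l1dist. Qed.

Lemma lipschitz_cst c : lipschitz_fun (fun=> c).
Proof. by exists 0 => // z z'; rewrite subrr normr0 mul0r. Qed.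

Lemma lipschitzD g h : lipschitz_fun g -> lipschitz_fun h ->
  lipschitz_fun (fun z => g z + h z).
Proof.
move=> [C C0 hC] [D D0 hD]; exists (C + D); first exact: addr_ge0.
move=> z z'; rewrite opprD addrACA mulrDl.
by apply: (le_trans (ler_normD _ _)); rewrite lerD.
Qed.

Lemma lipschitzN g : lipschitz_fun g -> lipschitz_fun (fun z => - g z).
Proof.
by move=> [C C0 hC]; exists C => // z z'; rewrite -opprD normrN.
Qed.

Lemma lipschitz_enorm (p : R) g h : 0 <= p -> lipschitz_fun g -> lipschitz_fun h ->
  lipschitz_fun (fun z => enorm p (g z, h z)).
Proof.
move=> p0 [C C0 hC] [D D0 hD]; have sp := sqrtr_ge0 p.
exists (C + Num.sqrt p * D); first by rewrite addr_ge0// mulr_ge0.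
move=> z z'; apply: (le_trans (enorm_lip _ _ p0)); rewrite mulrDl -mulrA lerD//=.
by rewrite ler_wpM2l.
Qed.

Lemma blip_cst c : blip (fun=> c).
Proof. by split; [exact: lipschitz_cst|exists `|c|]. Qed.

Lemma blipD g h : blip g -> blip h -> blip (fun z => g z + h z).
Proof.
move=> [lg [M M0 hM]] [lh [N N0 hN]]; split; first exact: lipschitzD.
exists (M + N); first exact: addr_ge0.
by move=> z; apply: (le_trans (ler_normD _ _)); rewrite lerD.
Qed.

Lemma blipN g : blip g -> blip (fun z => - g z).
Proof.
move=> [lg [M M0 hM]]; split; first exact: lipschitzN.
by exists M => // z; rewrite normrN.
Qed.

Lemma blipB g h : blip g -> blip h -> blip (fun z => g z - h z).
Proof. by move=> bg bh; apply: blipD bg (blipN bh). Qed.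

Lemma blipM g h : blip g -> blip h -> blip (fun z => g z * h z).
Proof.
move=> [[C C0 hC] [M M0 hM]] [[D D0 hD] [N N0 hN]]; split; last first.
  by exists (M * N) => [|z]; [exact: mulr_ge0|rewrite normrM ler_pM].
exists (M * D + N * C) => [|z z']; first by rewrite addr_ge0// mulr_ge0.
have -> : g z * h z - g z' * h z' = g z * (h z - h z') + h z' * (g z - g z') by ring.
apply: (le_trans (ler_normD _ _)); rewrite !normrM mulrDl -!mulrA.
by rewrite lerD//; apply: ler_pM.
Qed.

Lemma blip_sqr g : blip g -> blip (fun z => g z ^+ 2).
Proof. by move=> bg; exact: blipM. Qed.

Lemma blip_sum (J : Type) (r : seq J) (P : pred J) (g : J -> (I -> R) -> R) :
  (forall j, P j -> blip (g j)) -> blip (fun z => \sum_(j <- r | P j) g j z).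
Proof.
move=> hg; elim: r => [|j r ih].
  rewrite (_ : (fun z => _) = fun=> 0); first exact: blip_cst.
  by apply/funext => z; rewrite big_nil.
rewrite (_ : (fun z => _) = fun z =>
  if P j then g j z + \sum_(k <- r | P k) g k z else \sum_(k <- r | P k) g k z).
  by case Pj: (P j) => //; apply: blipD ih; exact: hg.
by apply/funext => z; rewrite big_cons.
Qed.

Lemma blipV g (e : R) : 0 < e -> (forall z, e <= g z) -> blip g ->
  blip (fun z => (g z)^-1).
Proof.
move=> e0 ge [[C C0 hC] _].
have g0 z : 0 < g z := lt_le_trans e0 (ge z).
have gV z : `|(g z)^-1| <= e^-1.
  by rewrite gtr0_norm ?invr_gt0// lef_pV2 ?posrE.
split; last by exists e^-1 => //; rewrite invr_ge0 ltW.
exists (e^-1 * e^-1 * C) => [|z z']; first by rewrite !mulr_ge0// invr_ge0 ltW.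
have -> : (g z)^-1 - (g z')^-1 = (g z)^-1 * (g z')^-1 * (g z' - g z).
  by field; rewrite !gt_eqF.
rewrite !normrM distrC -mulrA -[leRHS]mulrA -[leRHS]mulrA.
by apply: ler_pM => //; apply: ler_pM.
Qed.

(** The entry point of V' and U', which are Lipschitz on compact subintervals of their domains but
    not globally. *)
Lemma blip_comp_clamp (phi : R -> R) (l v : R) g : l <= v ->
  (exists2 C, 0 <= C & forall x y, l <= x <= v -> l <= y <= v ->
     `|phi x - phi y| <= C * `|x - y|) ->
  lipschitz_fun g -> blip (fun z => phi (clamp l v (g z))).
Proof.
move=> lv [C C0 hC] [D D0 hD]; split.
  exists (C * D) => [|z z']; first exact: mulr_ge0.
  apply: (le_trans (hC _ _ (clamp_itv _ lv) (clamp_itv _ lv))).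
  rewrite -mulrA ler_wpM2l//; exact: le_trans (clamp_lip _ _ _ _) (hD _ _).
exists (`|phi l| + C * (v - l)) => [|z].
  by rewrite addr_ge0// mulr_ge0// subr_ge0.
have cl := clamp_itv (g z) lv; set x := clamp _ _ _ in cl *.
have ll : l <= l <= v by rewrite lexx.
rewrite -[phi x](subrK (phi l)) addrC; apply: (le_trans (ler_normD _ _)).
rewrite lerD2l; apply: (le_trans (hC x l cl ll)); rewrite ler_wpM2l//.
by rewrite ger0_norm; case/andP: cl => *; rewrite ?subr_ge0// lerD2r.
Qed.

Lemma blip_clamp (l v : R) g : l <= v -> lipschitz_fun g ->
  blip (fun z => clamp l v (g z)).
Proof.
move=> lv; apply: (blip_comp_clamp (phi := id) lv).
by exists 1 => // x y _ _; rewrite mul1r.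
Qed.

Lemma blip_comp (phi : R -> R) g :
  (forall c, exists2 C, 0 <= C & forall x y, - c <= x <= c -> - c <= y <= c ->
     `|phi x - phi y| <= C * `|x - y|) ->
  blip g -> blip (fun z => phi (g z)).
Proof.
move=> hphi [lg [M M0 hM]].
rewrite (_ : (fun z => _) = fun z => phi (clamp (- M) M (g z))).
  by apply: blip_comp_clamp => //; lra.
by apply/funext => z; rewrite clamp_id// -ler_norml.
Qed.

Lemma blip_uniform (J : finType) (g : J -> (I -> R) -> R) :
  (forall j, blip (g j)) ->
  exists M C, [/\ 0 <= M, 0 <= C, forall j z, `|g j z| <= M
    & forall j z z', `|g j z - g j z'| <= C * l1dist z z'].
Proof.
move=> bg; have /choice[M hM] : forall j, exists M, 0 <= M /\ forall z, `|g j z| <= M.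
  by move=> j; have [_ [M M0 hM]] := bg j; exists M.
have /choice[C hC] : forall j, exists C, 0 <= C /\
    forall z z', `|g j z - g j z'| <= C * l1dist z z'.
  by move=> j; have [[C C0 hC] _] := bg j; exists C.
have M0 j : 0 <= M j by case: (hM j).
have C0 j : 0 <= C j by case: (hC j).
exists (\sum_j M j), (\sum_j C j); split; rewrite ?sumr_ge0// => j.
  move=> z; apply: (le_trans ((hM j).2 z)).
  by rewrite (bigD1 j)//= lerDl sumr_ge0.
move=> z z'; apply: (le_trans ((hC j).2 z z')); rewrite ler_wpM2r ?l1dist_ge0//.
by rewrite (bigD1 j)//= lerDl sumr_ge0.
Qed.

End BoundedLipschitz.

(** * The vehicle model *)

Section Model.
Context {R : realType} {n : nat}.
Variables (a lambda L p A mu1 mu2 vmax vstar phi : R) (V U f : R -> R).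
Hypotheses (ha : 0 < a) (hL : 0 < L) (hlambda : L < lambda)
    (hp : 1 <= p) (hA : 0 < A) (hmu1 : 0 < mu1) (hmu2 : 0 < mu2)
    (hvmax : 0 < vmax) (hvstar : 0 < vstar < vmax)
    (hphi : 0 < phi < pi / 2) (hcos : vstar / vmax <= cos phi)
    (hVC2 : C_on 2 [set d | L < d] V)
    (hVge0 : forall d, L < d -> 0 <= V d)
    (hVlim : V d @[d --> L^'+] --> +oo)
    (hV0 : forall d, lambda <= d -> V d = 0)
    (hUC2 : C_on 2 [set y | - a < y < a] U)
    (hUge0 : forall y, - a < y < a -> 0 <= U y)
    (hUliml : U y @[y --> (- a)^'+] --> +oo)
    (hUlimr : U y @[y --> a^'-] --> +oo)
    (hU0 : U 0 = 0)
    (hfC1 : C_on 1 [set: R] f)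
    (hf : forall x, Num.max x 0 <= f x).

Local Notation Om := (@Omega R n a phi vmax L p).
Local Notation H := (@energy R n p A phi vstar V U).
Local Notation F := (@accel R n p vmax vstar mu2 V f).
Local Notation u := (@steer R n p A phi vmax vstar mu1 mu2 V U f).
Local Notation m := ((max_packing p L lambda)%:R : R).
Local Notation X := (@Xforce R n p V).
Local Notation Y := (@Yforce R n p V).
Local Notation K := (@gain R n p vmax vstar mu2 V f).
Implicit Types (w : state R n) (i j : 'I_n) (s : R).

Lemma p_ge0 : 0 <= p. Proof. exact: le_trans hp. Qed.

Lemma vstar_gt0 : 0 < vstar. Proof. by case/andP: hvstar. Qed.

Lemma phi_lt_pi : 0 < phi < pi.
Proof. by case/andP: hphi => -> /=; have := pi_gt0 R; lra. Qed.

Lemma cos_lt_norm (x y : R) : `|x| < y -> y <= pi -> cos y < cos x.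
Proof.
move=> xy ypi; have nx := normr_ge0 x; have nxy := ltW xy.
rewrite -(cos_norm x) ltr_cos ?in_itv//= ?nx ?ypi ?(le_trans nx nxy)//.
exact: le_trans ypi.
Qed.

Lemma cphi_itv : 0 < cos phi < 1.
Proof.
case/andP: hphi => p0 ppi; rewrite cos_gt0_pihalf ?ppi/=; last by lra.
rewrite -cos0 cos_lt_norm ?normr0//.
by case/andP: phi_lt_pi => _ /ltW.
Qed.

Lemma vstar_le_cphi : vstar <= vmax * cos phi.
Proof. by move: hcos; rewrite ler_pdivrMr// mulrC. Qed.

(** * Pointwise consequences of membership in Omega; terms of the energy *)

Section Pointwise.
Variable w : state R n.
Hypothesis hw : Om w.

Lemma py_itv i : - a < py w i < a. Proof. by case: hw => /(_ i)[]. Qed.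

Lemma speed_itv i : 0 < speed w i < vmax. Proof. by case: hw => /(_ i)[]. Qed.

Lemma theta_lt i : `|theta w i| < phi.
Proof. by rewrite ltr_norml; case: hw => /(_ i)[]. Qed.

Lemma dist_gt i j : j != i -> L < dist p w i j. Proof. by case: hw => _; apply. Qed.

Lemma cos_theta_gt i : cos phi < cos (theta w i).
Proof. by apply: cos_lt_norm (theta_lt i) _; case/andP: phi_lt_pi => _ /ltW. Qed.

Lemma cos_theta_gt0 i : 0 < cos (theta w i).
Proof. by apply: lt_trans (cos_theta_gt i); case/andP: cphi_itv. Qed.

Lemma vmax_cos_gt i : vstar < vmax * cos (theta w i).
Proof. by apply: le_lt_trans vstar_le_cphi _; rewrite ltr_pM2l// cos_theta_gt. Qed.

Lemma dist_sym i j : dist p w i j = dist p w j i.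
Proof. by rewrite /dist /enorm/= -opprB sqrrN -[py w i - _]opprB sqrrN. Qed.

Lemma barrier_ge0 i : 0 <= (cos (theta w i) - cos phi)^-1 - (1 - cos phi)^-1.
Proof.
have /andP[_ c1] := cphi_itv; have h := cos_theta_gt i.
rewrite subr_ge0 lef_pV2 ?posrE ?subr_gt0// lerD2r; exact: cos_le1.
Qed.

Let V0 i j : j != i -> 0 <= V (dist p w i j).
Proof. by move=> ji; apply/hVge0/dist_gt. Qed.

Let U0 i : 0 <= U (py w i). Proof. exact/hUge0/py_itv. Qed.

Let SV0 i : 0 <= \sum_(j < n | j != i) V (dist p w i j).
Proof. exact: sumr_ge0 (@V0 i). Qed.

Lemma energy_terms :
  [/\ 0 <= 2^-1 * (\sum_(i < n) (speed w i * cos (theta w i) - vstar) ^+ 2)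
      + 2^-1 * (\sum_(i < n) speed w i ^+ 2 * sin (theta w i) ^+ 2),
    0 <= \sum_(i < n) U (py w i),
    0 <= 2^-1 * (\sum_(i < n) \sum_(j < n | j != i) V (dist p w i j))
  & 0 <= A * (\sum_(i < n) ((cos (theta w i) - cos phi)^-1 - (1 - cos phi)^-1))].
Proof.
have half : 0 <= 2^-1 :> R by rewrite invr_ge0.
split.
- rewrite addr_ge0// mulr_ge0// sumr_ge0// => i _; rewrite ?sqr_ge0//.
  by rewrite mulr_ge0// sqr_ge0.
- by apply: sumr_ge0 => i _; exact: U0.
- by rewrite mulr_ge0// sumr_ge0.
- by rewrite mulr_ge0 ?(ltW hA)// sumr_ge0// => i _; exact: barrier_ge0.
Qed.

Lemma energy_ge0 : 0 <= H w.
Proof. by have [? ? ? ?] := energy_terms; rewrite /energy; lra. Qed.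

Lemma U_le_energy i : U (py w i) <= H w.
Proof.
have [? _ ? ?] := energy_terms; rewrite /energy.
have : U (py w i) <= \sum_(i < n) U (py w i).
  by rewrite (bigD1 i)//= lerDl sumr_ge0.
lra.
Qed.

Lemma barrier_le_energy i :
  A * ((cos (theta w i) - cos phi)^-1 - (1 - cos phi)^-1) <= H w.
Proof.
have [? ? ? _] := energy_terms; rewrite /energy.
set S := \sum_(i < n) (_ - _).
have : A * ((cos (theta w i) - cos phi)^-1 - (1 - cos phi)^-1) <= A * S.
  rewrite ler_pM2l// /S (bigD1 i)//= lerDl sumr_ge0// => j _.
  exact: barrier_ge0.
lra.
Qed.

(** The double sum contains the pair in both orders, which absorbs the factor 1/2. *)
Lemma V_le_energy i j : j != i -> V (dist p w i j) <= H w.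
Proof.
move=> ji; have [? ? _ ?] := energy_terms; rewrite /energy.
set S := \sum_(i < n) \sum_(j < n | _) _.
have : V (dist p w i j) + V (dist p w j i) <= S.
  rewrite /S (bigD1 i)//= lerD//.
    by rewrite (bigD1 j)//= lerDl sumr_ge0// => k /andP[ki _]; exact: V0.
  rewrite (bigD1 j)//= (bigD1 i) 1?eq_sym//= -addrA lerDl addr_ge0//.
    by apply: sumr_ge0 => k /andP[kj _]; exact: V0.
  by apply: sumr_ge0.
rewrite -(dist_sym i j); lra.
Qed.

End Pointwise.

(** * Distances to the boundary of Omega as functions of the energy *)

Definition kappa s : R := sup [set `|y| | y in [set y | - a < y < a /\ U y <= s]].

(** The cap at lambda gives [rho s <= lambda]. For s >= 0 the set contains lambda, where V vanishes,
    and pairs further apart than lambda satisfy the lower bound anyway. *)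
Definition rho s : R := inf [set d | L < d <= lambda /\ V d <= s].

(** The blow-up of U at both ends keeps its sublevel set at a fixed distance from them, so that the
    supremum stays strictly below a. *)
Let kappa_ubound s : exists2 c, c < a &
  ubound [set `|y| | y in [set y | - a < y < a /\ U y <= s]] c.
Proof.
have /cvgryPgt/(_ s)[e1 /= e10 h1] := hUlimr.
have /cvgryPgt/(_ s)[e2 /= e20 h2] := hUliml.
exists (a - Num.min e1 e2).
  by rewrite gtrBl lt_min e10 e20.
move=> _ [y [/andP[ay ya] Uy] <-]; rewrite leNgt; apply/negP => hy.
have [y0|y0] := ltP y 0.
  move: hy; rewrite ltr0_norm// => hy.
  have : s < U y.
    apply: h2 => //=; rewrite ltr0_norm ?subr_lt0//.
    have : Num.min e1 e2 <= e2 by rewrite ge_min lexx orbT.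
    lra.
  by rewrite ltNge Uy.
move: hy; rewrite ger0_norm// => hy.
have : s < U y.
  apply: h1 => //=; rewrite gtr0_norm ?subr_gt0//.
  have : Num.min e1 e2 <= e1 by rewrite ge_min lexx.
  lra.
by rewrite ltNge Uy.
Qed.

Let kappa_mem0 s : 0 <= s ->
  [set `|y| | y in [set y | - a < y < a /\ U y <= s]] 0.
Proof. by move=> s0; exists 0; rewrite ?normr0//=; split; rewrite ?hU0// oppr_lt0 ha. Qed.

Lemma kappa_itv s : 0 <= s -> 0 <= kappa s < a.
Proof.
move=> s0; have [c ca hc] := kappa_ubound s; apply/andP; split.
  by apply: ub_le_sup; [exists c | exact: kappa_mem0].
by apply: le_lt_trans ca; apply: ge_sup => //; exists 0; exact: kappa_mem0.
Qed.

Lemma norm_le_kappa s y : - a < y < a -> U y <= s -> `|y| <= kappa s.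
Proof.
move=> ay Uy; have [c _ hc] := kappa_ubound s.
by apply: ub_le_sup; [exists c | exists y].
Qed.

Lemma kappa_le s s' : 0 <= s -> s <= s' -> kappa s <= kappa s'.
Proof.
move=> s0 ss'; apply: ge_sup; first by exists 0; exact: kappa_mem0.
move=> _ [y [ay Uy] <-]; apply: norm_le_kappa => //; exact: le_trans ss'.
Qed.

Let rho_lbound s : exists2 c, L < c & lbound [set d | L < d <= lambda /\ V d <= s] c.
Proof.
have /cvgryPgt/(_ s)[e /= e0 h] := hVlim.
exists (L + e); first by rewrite ltrDl.
move=> d [/andP[Ld _] Vd]; rewrite leNgt; apply/negP => hd.
have : s < V d by apply: h => //=; rewrite ltr0_norm ?subr_lt0//; lra.
by rewrite ltNge Vd.
Qed.

Let rho_mem s : 0 <= s -> [set d | L < d <= lambda /\ V d <= s] lambda.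
Proof. by move=> s0 /=; rewrite hlambda lexx hV0. Qed.

Lemma rho_itv s : 0 <= s -> L < rho s <= lambda.
Proof.
move=> s0; have [c Lc hc] := rho_lbound s; apply/andP; split.
  by apply: (lt_le_trans Lc); apply: lb_le_inf => //; exists lambda; exact: rho_mem.
by apply: ge_inf; [exists c | exact: rho_mem].
Qed.

Lemma rho_le_of_V s d : 0 <= s -> L < d -> V d <= s -> rho s <= d.
Proof.
move=> s0 Ld Vd; have [dl|/ltW ld] := leP d lambda; last first.
  by apply: le_trans ld; case/andP: (rho_itv s0).
have [c _ hc] := rho_lbound s.
by apply: ge_inf; [exists c | rewrite /= Ld dl].
Qed.

Lemma rho_ge s s' : 0 <= s -> s <= s' -> rho s' <= rho s.
Proof.
move=> s0 ss'; apply: lb_le_inf; first by exists lambda; exact: rho_mem.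
move=> d [/andP[Ld _] Vd]; apply: rho_le_of_V => //; first exact: le_trans ss'.
exact: le_trans ss'.
Qed.

(* [cmin s] solves A (1 / (x - cos phi) - 1 / (1 - cos phi)) = s for x. *)
Definition cmin s : R := cos phi + A * (1 - cos phi) / (A + s * (1 - cos phi)).

Let cmin_den s : 0 <= s -> 0 < A + s * (1 - cos phi).
Proof.
move=> s0; have /andP[_ c1] := cphi_itv.
by rewrite ltr_wpDr// mulr_ge0// subr_ge0 ltW.
Qed.

Lemma cmin_gt s : 0 <= s -> cos phi < cmin s.
Proof.
move=> s0; have /andP[_ c1] := cphi_itv.
by rewrite /cmin ltrDl divr_gt0 ?cmin_den// mulr_gt0// subr_gt0.
Qed.

Lemma cmin_le1 s : 0 <= s -> cmin s <= 1.
Proof.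
move=> s0; have /andP[_ c1] := cphi_itv.
rewrite /cmin -lerBrDl ler_pdivrMr ?cmin_den//.
have : 0 <= s * (1 - cos phi) * (1 - cos phi) by rewrite !mulr_ge0// subr_ge0 ltW.
lra.
Qed.

Lemma cmin_le_cos s w i : Om w -> H w <= s -> cmin s <= cos (theta w i).
Proof.
move=> hw Hs; have s0 := le_trans (energy_ge0 hw) Hs.
have := le_trans (barrier_le_energy hw i) Hs.
have := cos_theta_gt hw i; have /andP[_] := cphi_itv.
rewrite -!(subr_gt0 (cos phi)); set q := 1 - _; set x := cos _ - _ => q0 x0 h.
have : A * q <= x * (A + s * q).
  have : A * (x^-1 - q^-1) * (x * q) <= s * (x * q).
    by rewrite ler_pM2r// mulr_gt0.
  have -> : A * (x^-1 - q^-1) * (x * q) = A * (q - x).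
    by field; rewrite !gt_eqF.
  lra.
by rewrite /cmin -/q -lerBrDl -/x ler_pdivrMr ?cmin_den.
Qed.

Lemma V_derivable d : L < d -> derivable V d 1.
Proof. by move=> Ld; apply: (hVC2.1 0%N). Qed.

Lemma V'_derivable d : L < d -> derivable (derive1 V) d 1.
Proof. by move=> Ld; apply: (hVC2.1 1%N). Qed.

Lemma V''_continuous d : L < d -> {for d, continuous (derive1 (derive1 V))}.
Proof. by move=> Ld; apply: hVC2.2. Qed.

Lemma U_derivable y : - a < y < a -> derivable U y 1.
Proof. by move=> ay; apply: (hUC2.1 0%N). Qed.

Lemma U'_derivable y : - a < y < a -> derivable (derive1 U) y 1.
Proof. by move=> ay; apply: (hUC2.1 1%N). Qed.

Lemma U''_continuous y : - a < y < a -> {for y, continuous (derive1 (derive1 U))}.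
Proof. by move=> ay; apply: hUC2.2. Qed.

Lemma f_derivable x : derivable f x 1.
Proof. exact: (hfC1.1 0%N). Qed.

Lemma f'_continuous x : {for x, continuous (derive1 f)}.
Proof. exact: hfC1.2. Qed.

Lemma f_ge0 x : 0 <= f x.
Proof. by apply: le_trans (hf x); rewrite le_max lexx orbT. Qed.

Lemma f_ge x : x <= f x.
Proof. by apply: le_trans (hf x); rewrite le_max lexx. Qed.

(* V attains its minimum 0 at every point of [lambda, +oo). *)
Lemma V'_eq0 d : lambda <= d -> derive1 V d = 0.
Proof.
move=> ld; have Ld : L < d by apply: lt_le_trans ld.
have /(@derive_val _ _ _ _ _ _ _) <- : is_derive d 1 V 0.
  apply: (@derive1_at_min _ V L (d + 1)).
  - by lra.
  - by move=> t; rewrite in_itv/= => /andP[Lt _]; exact: V_derivable.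
  - by rewrite in_itv/= Ld/=; lra.
  - by move=> t; rewrite in_itv/= => /andP[Lt _]; rewrite (hV0 ld) hVge0.
by rewrite derive1E.
Qed.

Lemma norm_V'_le_b1 s d : L < s -> s <= d <= lambda -> `|derive1 V d| <= b1 lambda V s.
Proof.
move=> Ls sd; apply: (@le_maximum_image _ _ (fun d => `|derive1 V d|) s lambda) => // y /andP[sy _].
apply: (continuous_comp _ (@norm_continuous _ _ _)).
apply: is_derive1_continuous; apply/derivable1_deriv/V'_derivable.
exact: lt_le_trans sy.
Qed.

Lemma b1_ge0 s : L < s <= lambda -> 0 <= b1 lambda V s.
Proof.
move=> /andP[Ls sl]; apply: le_trans (@norm_V'_le_b1 s s Ls _); rewrite ?normr_ge0//.
by rewrite lexx.
Qed.

Lemma norm_U'_le_b2 s y : s < a -> `|y| <= s -> `|derive1 U y| <= b2 U s.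
Proof.
move=> sa ys; apply: (@le_maximum_image _ _ (fun y => `|derive1 U y|) (- s) s) => //.
  by apply/seteqP; split => x /=; rewrite ler_norml.
move=> x /andP[sx xs].
apply: (continuous_comp _ (@norm_continuous _ _ _)).
apply: is_derive1_continuous; apply/derivable1_deriv/U'_derivable; lra.
Qed.

Lemma f_le_max c x : `|x| <= c -> f x <= maximum 0 [set f z | z in [set z | `|z| <= c]].
Proof.
move=> xc; apply: (@le_maximum_image _ _ f (- c) c) => //.
  by apply/seteqP; split => y /=; rewrite ler_norml.
by move=> y _; apply: is_derive1_continuous; exact/derivable1_deriv/f_derivable.
Qed.

Lemma Rb_ge s : 0 <= s -> mu2 <= Rbound lambda L p A phi vmax vstar mu2 V f rho s.
Proof.
move=> s0; have b10 := b1_ge0 (rho_itv s0).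
have v0 := vstar_gt0; have /andP[c0 c1] := cphi_itv; have hc := vstar_le_cphi.
have q0 : 0 <= 1 - cos phi by rewrite subr_ge0 ltW.
have mb : 0 <= m * b1 lambda V (rho s) by rewrite mulr_ge0.
have M0 : 0 <= maximum 0 [set f z | z in [set z | `|z| <= m * b1 lambda V (rho s)]].
  by apply: le_trans (f_ge0 0) (f_le_max _); rewrite normr0.
have /andP[_ vv] := hvstar.
rewrite /Rbound -addrA lerDl addr_ge0//.
  by rewrite mulr_ge0// divr_ge0// ltW.
rewrite mulr_ge0 ?(ltW hvmax)// divr_ge0// ?mulr_ge0//.
  by rewrite addr_ge0 ?(ltW hA)// !mulr_ge0// ltW.
rewrite addr_ge0// !mulr_ge0// ?subr_ge0// ltW//.
Qed.

(** * Bounds on the feedback over a sublevel set of the energy *)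

Section Bounds.
Variables (w : state R n) (s : R).
Hypotheses (hw : Om w) (Hs : H w <= s).

Let s0 : 0 <= s. Proof. exact: le_trans (energy_ge0 hw) Hs. Qed.

Lemma py_le_kappa i : `|py w i| <= kappa s.
Proof. exact/norm_le_kappa/(le_trans (U_le_energy hw i))/Hs/py_itv. Qed.

Lemma rho_le_dist i j : j != i -> rho s <= dist p w i j.
Proof.
move=> ji; apply: rho_le_of_V => //; first exact: dist_gt.
exact: le_trans (V_le_energy hw ji) Hs.
Qed.

Lemma card_neighbours i :
  (#|[pred j | (j != i) && (dist p w i j <= lambda)%R]| <= max_packing p L lambda)%N.
Proof.
set S := [pred j | _].
pose g j := (px w i - px w j, py w i - py w j).
apply: packing_le_max p_ge0 hL _.
exists [seq g j | j <- enum S].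
have gE j k : enorm p ((g j).1 - (g k).1, (g j).2 - (g k).2) = dist p w k j.
  by rewrite /dist /g/=; congr (enorm _ (_, _)); ring.
split.
- rewrite map_inj_in_uniq ?enum_uniq// => j k _ _ [e1 e2].
  apply/eqP; apply: contraT => jk; have := dist_gt hw jk.
  have -> : dist p w k j = 0.
    rewrite /dist /enorm/= (_ : px w k = px w j); last lra.
    by rewrite (_ : py w k = py w j) ?subrr ?expr0n ?mulr0 ?addr0 ?sqrtr0//; lra.
  by rewrite ltNge (ltW hL).
- by rewrite size_map -cardE.
- move=> _ /mapP[j + ->]; rewrite mem_enum inE => /andP[ji dl].
  rewrite -(enorm_sqr (g j) p_ge0) -/(dist p w i j).
  have Ld := ltW (dist_gt hw ji).
  have L0 := ltW hL; have d0 := le_trans L0 Ld.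
  by rewrite !ler_sqr ?nnegrE ?Ld// (le_trans d0).
- move=> _ _ /mapP[j _ ->] /mapP[k _ ->] jk; rewrite gE ltW//; apply: dist_gt => //.
  by apply: contraNneq jk => ->.
Qed.

Lemma norm_pair_sum i (h : 'I_n -> R) (B : R) :
  0 <= B ->
  (forall j, j != i -> dist p w i j <= lambda -> `|h j| <= B) ->
  (forall j, j != i -> lambda < dist p w i j -> h j = 0) ->
  `|\sum_(j < n | j != i) h j| <= m * B.
Proof.
move=> B0 hB h0; set S := [pred j | (j != i) && (dist p w i j <= lambda)].
have -> : \sum_(j < n | j != i) h j = \sum_(j in S) h j.
  rewrite (bigID (fun j => dist p w i j <= lambda))/= [X in _ + X]big1 ?addr0.
    by apply: eq_bigl => j; rewrite inE.
  by move=> j /andP[ji]; rewrite -ltNge; exact: h0.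
apply: (le_trans (ler_norm_sum _ _ _)).
apply: (@le_trans _ _ (\sum_(j in S) B)).
  by apply: ler_sum => j; rewrite inE => /andP[]; exact: hB.
rewrite sumr_const -[leLHS]mulr_natl ler_wpM2r// ler_nat; exact: card_neighbours.
Qed.

Let b10 : 0 <= b1 lambda V (rho s). Proof. by apply: b1_ge0; exact: rho_itv. Qed.

Let norm_V'_dist i j : j != i -> dist p w i j <= lambda ->
  `|derive1 V (dist p w i j)| <= b1 lambda V (rho s).
Proof.
move=> ji dl; apply: norm_V'_le_b1; first by case/andP: (rho_itv s0).
by rewrite rho_le_dist.
Qed.

Lemma norm_X_le i : `|X w i| <= m * b1 lambda V (rho s).
Proof.
apply: norm_pair_sum => // [j ji dl|j ji ld]; last first.
  by rewrite V'_eq0 ?mul0r// ltW.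
rewrite normrM -[leRHS]mulr1; apply: ler_pM => //; first exact: norm_V'_dist.
have d0 : 0 < dist p w i j := lt_trans hL (dist_gt hw ji).
rewrite normrM normfV (gtr0_norm d0) ler_pdivrMr// mul1r.
exact: (@norm_fst_le_enorm _ p (px w i - px w j, py w i - py w j) p_ge0).
Qed.

(** Split p as a product of two square roots: one is absorbed by sqrt p |y_i - y_j| <= d_{i,j}, the
    other survives as the sqrt p of the final bound on u. *)
Lemma norm_Y_le i : p * `|Y w i| <= m * Num.sqrt p * b1 lambda V (rho s).
Proof.
have sp := sqrtr_ge0 p.
have -> : p * `|Y w i| = Num.sqrt p * `|Num.sqrt p * Y w i|.
  by rewrite normrM (ger0_norm sp) mulrA -expr2 sqr_sqrtr// p_ge0.
rewrite -mulrA mulrCA ler_wpM2l// /Yforce mulr_sumr.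
apply: norm_pair_sum => // [j ji dl|j ji ld]; last first.
  by rewrite V'_eq0 ?mul0r ?mulr0// ltW.
rewrite mulrCA normrM -[leRHS]mulr1; apply: ler_pM => //; first exact: norm_V'_dist.
have d0 : 0 < dist p w i j := lt_trans hL (dist_gt hw ji).
rewrite mulrA normrM normfV (gtr0_norm d0) ler_pdivrMr// mul1r.
rewrite normrM (ger0_norm sp).
exact: (@norm_snd_le_enorm _ p (px w i - px w j, py w i - py w j) p_ge0).
Qed.

Local Notation Rb := (Rbound lambda L p A phi vmax vstar mu2 V f rho s).

Lemma gain_coef_ge i :
  vstar^-1 <= vmax * cos (theta w i) / (vstar * (vmax * cos (theta w i) - vstar)).
Proof.
have v0 := vstar_gt0; have h := vmax_cos_gt hw i.
rewrite ler_pdivlMr ?mulr_gt0// ?subr_gt0// mulrA mulVf ?gt_eqF// mul1r; lra.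
Qed.

(** The coefficient decreases with cos theta. The right side is its value at [cmin s], the least
    cosine allowed by H <= s, cleared of the denominator A + s (1 - cos phi); this is the origin of
    the fraction in R. *)
Lemma gain_coef_le i :
  vmax * cos (theta w i) / (vstar * (vmax * cos (theta w i) - vstar)) <=
  vmax * ((A + s * cos phi * (1 - cos phi))
   / (A * vstar * (vmax - vstar)
        + vstar * (vmax * cos phi - vstar) * (1 - cos phi) * s)).
Proof.
have v0 := vstar_gt0; have h := vmax_cos_gt hw i.
have /andP[c0 c1] := cphi_itv; have q0 : 0 < 1 - cos phi by rewrite subr_gt0.
have hc := vstar_le_cphi; have /andP[_ vv] := hvstar.
have den0 : 0 < A * vstar * (vmax - vstar)
        + vstar * (vmax * cos phi - vstar) * (1 - cos phi) * s.
  rewrite ltr_pwDl// ?mulr_gt0// ?subr_gt0// mulr_ge0//.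
  by rewrite mulr_ge0 ?(ltW q0)// mulr_ge0 ?(ltW v0)// subr_ge0.
rewrite -mulrA ler_pM2l// ler_pdivrMr ?mulr_gt0// ?subr_gt0//.
rewrite [leRHS]mulrAC ler_pdivlMr//.
have := cmin_le_cos i hw Hs; rewrite /cmin -lerBrDl ler_pdivrMr; last first.
  by rewrite ltr_wpDr// mulr_ge0// ltW.
(* After cross-multiplication the terms in vmax * x cancel, and what is left is vstar^2 times the
   bound of [cmin_le_cos]. *)
rewrite -(ler_pM2l (mulr_gt0 v0 v0)); set x := cos (theta _ _); lra.
Qed.

(** The coefficient of f(- X) is at least 1 / vstar and f(- X) >= - X, so the third term of the gain
    makes up for a negative second one. *)
Lemma gain_ge i : mu2 <= K w i.
Proof.
rewrite /gain -addrA lerDl.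
have v0 : 0 < vstar^-1 by rewrite invr_gt0 vstar_gt0.
have := ler_wpM2r (f_ge0 (- X w i)) (gain_coef_ge i).
have : vstar^-1 * (- X w i) <= vstar^-1 * f (- X w i) by rewrite ler_pM2l// f_ge.
rewrite mulrN; lra.
Qed.

(** The left side is the gain without its term X / vstar, the factor that occurs in the positive
    part of [accelE]. *)
Lemma gain_term_le i :
  mu2 + vmax * cos (theta w i) / (vstar * (vmax * cos (theta w i) - vstar))
      * f (- X w i) <= Rb - m / vstar * b1 lambda V (rho s).
Proof.
rewrite /Rbound; set M := maximum _ _.
have fM : f (- X w i) <= M by apply: f_le_max; rewrite normrN; exact: norm_X_le.
rewrite -!addrA lerD2l; rewrite [leRHS]addrCA subrr addr0.
rewrite [X in _ <= vmax * X]mulrAC [leRHS]mulrA; apply: ler_pM => //.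
- by apply: le_trans (gain_coef_ge i); rewrite invr_ge0 ltW// vstar_gt0.
- exact: f_ge0.
- exact: gain_coef_le.
Qed.

Lemma gain_le i : K w i <= Rb.
Proof.
have := gain_term_le i; rewrite /gain.
have : vstar^-1 * X w i <= m / vstar * b1 lambda V (rho s).
  rewrite mulrAC [leRHS]mulrC ler_pM2l ?invr_gt0 ?vstar_gt0//.
  by apply: le_trans (norm_X_le i); exact: ler_norm.
lra.
Qed.

(* The feedback in the form v' = - k v + c with c > 0. *)
Lemma accelE i : F w i = - K w i * speed w i +
  vstar / cos (theta w i) *
  (mu2 + vmax * cos (theta w i) / (vstar * (vmax * cos (theta w i) - vstar))
      * f (- X w i)).
Proof.
have c0 := cos_theta_gt0 hw i; have v0 := vstar_gt0; have h := vmax_cos_gt hw i.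
rewrite /accel /gain; set fx := f _; field.
by rewrite !gt_eqF ?subr_gt0.
Qed.

(** In [accelE] the damping K v and the positive part both lie in [0, R vmax], so their difference
    is bounded without a factor 2. For the positive part, vstar / cos theta < vmax. *)
Lemma norm_accel_le i : `|F w i| <= Rb * vmax.
Proof.
rewrite accelE; have c0 := cos_theta_gt0 hw i; have v0 := vstar_gt0.
have h := vmax_cos_gt hw i; have /andP[sp0 spv] := speed_itv hw i.
set G := mu2 + _.
have G0 : 0 <= G.
  rewrite addr_ge0 ?(ltW hmu2)// mulr_ge0 ?f_ge0//.
  by apply: le_trans (gain_coef_ge i); rewrite invr_ge0 ltW// vstar_gt0.
have GR : G <= Rb.
  apply: (le_trans (gain_term_le i)); rewrite gerBl mulr_ge0// divr_ge0// ltW//.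
have k0 : 0 <= K w i by apply: le_trans (gain_ge i); exact: ltW.
have R0 : 0 <= Rb by apply: le_trans (Rb_ge s0); exact: ltW.
have vc : 0 <= vstar / cos (theta w i) <= vmax.
  by rewrite divr_ge0 ?(ltW c0) ?(ltW v0)//= ler_pdivrMr// ltW.
case/andP: vc => vc0 vc.
have h1 : 0 <= vstar / cos (theta w i) * G <= Rb * vmax.
  by rewrite mulr_ge0//= mulrC ler_pM.
have h2 : 0 <= K w i * speed w i <= Rb * vmax.
  by rewrite mulr_ge0 ?(ltW sp0)//= ler_pM ?(ltW sp0) ?(ltW spv)// gain_le.
rewrite ler_norml; lra.
Qed.

Lemma norm_steer_le i : `|u w i| <= vstar^-1 * ((mu1 + Rb) * vmax + b2 U (kappa s)
                         + m * Num.sqrt p * b1 lambda V (rho s)).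
Proof.
have v0 := vstar_gt0; have /andP[sp0 spv] := speed_itv hw i.
have x0 : 0 < cos (theta w i) - cos phi by rewrite subr_gt0; exact: cos_theta_gt.
have B0 : 0 <= A / (speed w i * (cos (theta w i) - cos phi) ^+ 2).
  by rewrite divr_ge0 ?(ltW hA)// mulr_ge0 ?(ltW sp0)// sqr_ge0.
rewrite /steer mulNr normrN normrM normfV.
apply: ler_pM => //.
  rewrite ger0_norm; last by rewrite addr_ge0// ltW.
  by rewrite lef_pV2 ?posrE ?lerDl// ltr_wpDr.
have R0 : 0 <= Rb by apply: le_trans (Rb_ge s0); exact: ltW.
have s1 := sin_max (theta w i).
have h1 : `|mu1 * speed w i * sin (theta w i)| <= mu1 * vmax.
  rewrite normrM -[leRHS]mulr1 ler_pM// ger0_norm ?ler_pM2l ?(ltW spv)//.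
  by rewrite mulr_ge0 ?(ltW hmu1) ?(ltW sp0).
have h2 : `|derive1 U (py w i)| <= b2 U (kappa s).
  by apply: norm_U'_le_b2; [case/andP: (kappa_itv s0)|exact: py_le_kappa].
have h3 : `|p * Y w i| <= m * Num.sqrt p * b1 lambda V (rho s).
  by rewrite normrM ger0_norm ?p_ge0// norm_Y_le.
have h4 : `|sin (theta w i) * F w i| <= Rb * vmax.
  by rewrite normrM -[leRHS]mul1r ler_pM// norm_accel_le.
have := ler_normD (mu1 * speed w i * sin (theta w i) + derive1 U (py w i)
  + p * Y w i) (sin (theta w i) * F w i).
have := ler_normD (mu1 * speed w i * sin (theta w i) + derive1 U (py w i))
  (p * Y w i).
have := ler_normD (mu1 * speed w i * sin (theta w i)) (derive1 U (py w i)).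
rewrite mulrDl; lra.
Qed.

End Bounds.

(** * Energy dissipation *)

(** The equations with two-sided derivatives, the form on which the calculus lemmas act;
    [extend_solution] brings solutions that are one-sided at 0 into it. *)
Definition flow (z : R -> state R n) (t : R) : Prop := forall i,
  [/\ is_derive t 1 (fun r => px (z r) i) (speed (z t) i * cos (theta (z t) i)),
      is_derive t 1 (fun r => py (z r) i) (speed (z t) i * sin (theta (z t) i)),
      is_derive t 1 (fun r => theta (z r) i) (u (z t) i)
    & is_derive t 1 (fun r => speed (z r) i) (F (z t) i)].

Definition dissipation w : R :=
  \sum_(i < n) (K w i * (speed w i * cos (theta w i) - vstar) ^+ 2
                + mu1 * (speed w i * sin (theta w i)) ^+ 2).

(** Action and reaction: exchanging i and j turns the half with b_j into the half with b_i. Here g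
    is a component of the pair force and b the same component of the velocity. *)
Lemma antisym_pair_sum (g : 'I_n -> 'I_n -> R) (b : 'I_n -> R) :
  (forall i j, g j i = - g i j) ->
  \sum_(i < n) \sum_(j < n | j != i) g i j * (b i - b j) =
  2 * \sum_(i < n) b i * \sum_(j < n | j != i) g i j.
Proof.
move=> gN.
have e : \sum_(i < n) \sum_(j < n | j != i) g i j * b j =
         - \sum_(i < n) b i * \sum_(j < n | j != i) g i j.
  rewrite (exchange_big_dep predT)//= -sumrN; apply: eq_bigr => j _.
  rewrite mulr_sumr -sumrN; apply: eq_big => [i|i _]; first by rewrite eq_sym.
  by rewrite gN; ring.
under eq_bigr do under eq_bigr do rewrite mulrBr.
under eq_bigr do rewrite sumrB.
rewrite sumrB e opprK mulr2n mulrDl mul1r; congr (_ + _).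
by apply: eq_bigr => i _; rewrite mulr_sumr; apply: eq_bigr => j _; rewrite mulrC.
Qed.

(** Internal forces have no resultant. This removes the terms vstar * X_i of [dissipation_term],
    whose individual signs are unknown. *)
Lemma sum_X_eq0 w : \sum_(i < n) X w i = 0.
Proof.
rewrite /Xforce; set S := \sum_(i < n) _.
have : S = - S.
  rewrite {1}/S (exchange_big_dep predT)//= -sumrN; apply: eq_bigr => j _.
  rewrite -sumrN; apply: eq_big => [i|i _]; first by rewrite eq_sym.
  by rewrite dist_sym; ring.
lra.
Qed.

(** The share of one vehicle in dH/dt. F is designed to cancel X against v cos theta - vstar rather
    than v cos theta, hence the remainder vstar * X; u is designed to cancel U', Y and the lateral
    effect of F. *)
Lemma dissipation_term w i : Om w ->
  (speed w i * cos (theta w i) - vstar) * (F w i * cos (theta w i)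
     + speed w i * (- sin (theta w i) * u w i))
  + (speed w i * F w i * sin (theta w i) ^+ 2
     + speed w i ^+ 2 * (sin (theta w i) * (cos (theta w i) * u w i)))
  + derive1 U (py w i) * (speed w i * sin (theta w i))
  + (X w i * (speed w i * cos (theta w i))
     + p * Y w i * (speed w i * sin (theta w i)))
  + A * (- (cos (theta w i) - cos phi) ^- 2 * (- sin (theta w i) * u w i)) =
  vstar * X w i - (K w i * (speed w i * cos (theta w i) - vstar) ^+ 2
                + mu1 * (speed w i * sin (theta w i)) ^+ 2).
Proof.
move=> hw; have c0 := cos_theta_gt0 hw i; have v0 := vstar_gt0.
have /andP[sp0 _] := speed_itv hw i.
have : 0 < cos (theta w i) - cos phi by rewrite subr_gt0; exact: cos_theta_gt.
set v := speed w i; set x := _ - cos phi; set c := cos _; set sn := sin _ => x0.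
have hF : F w i * c = - K w i * (v * c - vstar) - X w i.
  by rewrite /accel -/c -/v; field; rewrite gt_eqF.
set W := mu1 * v * sn + derive1 U (py w i) + p * Y w i + sn * F w i.
(* In the share of the vehicle the terms in v^2 u cancel, and the left side here is all that remains
   of u: v sin theta times u times the bracket that the steering law inverts. *)
have hu : v * sn * vstar * u w i + A * sn * u w i * x ^- 2 = - (v * sn * W).
  have D0 : vstar + A / (v * x ^+ 2) != 0.
    by rewrite gt_eqF// addr_gt0// divr_gt0// mulr_gt0// exprn_gt0.
  rewrite (_ : u w i = - (vstar + A / (v * x ^+ 2))^-1 * W)//.
  have E0 : vstar * (v * x ^+ 2) + A != 0.
    by rewrite gt_eqF// addr_gt0// !mulr_gt0// exprn_gt0.
  by field; rewrite E0 !gt_eqF.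
have hF2 : F w i * c * (v * c - vstar) =
  (- K w i * (v * c - vstar) - X w i) * (v * c - vstar) by rewrite hF.
move: hu; rewrite /W; move: hF2.
set r := x ^- 2; set Fi := F w i; set ui := u w i; set Ki := K w i; lra.
Qed.

Lemma dist_deriv z t i j : Om (z t) -> flow z t -> j != i ->
  is_derive t 1 (fun r => dist p (z r) i j)
    ((px (z t) i - px (z t) j) / dist p (z t) i j *
     (speed (z t) i * cos (theta (z t) i) - speed (z t) j * cos (theta (z t) j))
    + p * ((py (z t) i - py (z t) j) / dist p (z t) i j) *
     (speed (z t) i * sin (theta (z t) i) - speed (z t) j * sin (theta (z t) j))).
Proof.
move=> hw hz ji; have d0 := lt_trans hL (dist_gt hw ji).
have [xi yi _ _] := hz i; have [xj yj _ _] := hz j.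
have q0 : 0 < (px (z t) i - px (z t) j) ^+ 2 + p * (py (z t) i - py (z t) j) ^+ 2.
  by move: d0; rewrite /dist sqrtr_gt0.
have Dq := is_derive1D (is_derive1_sqr (is_derive1B xi xj))
  (is_derive1Z p (is_derive1_sqr (is_derive1B yi yj))).
have D := is_derive1_compose (g := fun r => (px (z r) i - px (z r) j) ^+ 2
  + p * (py (z r) i - py (z r) j) ^+ 2) (is_derive1_sqrt q0) Dq.
apply: (is_derive1_eq (f := fun r => dist p (z r) i j) D).
rewrite -[Num.sqrt _]/(dist p (z t) i j); field; exact: lt0r_neq0.
Qed.

Lemma energy_deriv z t : Om (z t) -> flow z t ->
  is_derive t 1 (fun r => H (z r)) (- dissipation (z t)).
Proof.
move=> hw hz; set w := z t.
have d1 i : is_derive t 1 (fun r => (speed (z r) i * cos (theta (z r) i) - vstar) ^+ 2)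
    (2 * (speed w i * cos (theta w i) - vstar) * (F w i * cos (theta w i)
     + speed w i * (- sin (theta w i) * u w i))).
  have [_ _ th v] := hz i.
  apply: is_derive1_eq (is_derive1_sqr (is_derive1B (is_derive1M v
    (is_derive1_compose (is_derive_cos _) th)) (is_derive1_cst vstar t))) _.
  by rewrite subr0.
have d2 i : is_derive t 1 (fun r => speed (z r) i ^+ 2 * sin (theta (z r) i) ^+ 2)
    (2 * (speed w i * F w i * sin (theta w i) ^+ 2
     + speed w i ^+ 2 * (sin (theta w i) * (cos (theta w i) * u w i)))).
  have [_ _ th v] := hz i.
  apply: is_derive1_eq (is_derive1M (is_derive1_sqr v)
    (is_derive1_sqr (is_derive1_compose (is_derive_sin _) th))) _.
  by rewrite -/w; ring.
have d3 i : is_derive t 1 (fun r => U (py (z r) i))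
    (derive1 U (py w i) * (speed w i * sin (theta w i))).
  have [_ y _ _] := hz i.
  apply: is_derive1_compose y; apply/derivable1_deriv/U_derivable.
  exact: py_itv.
pose vx i := speed w i * cos (theta w i); pose vy i := speed w i * sin (theta w i).
have d4 i j : j != i -> is_derive t 1 (fun r => V (dist p (z r) i j))
    (derive1 V (dist p w i j) * ((px w i - px w j) / dist p w i j) * (vx i - vx j)
    + p * (derive1 V (dist p w i j) * ((py w i - py w j) / dist p w i j)) * (vy i - vy j)).
  move=> ji; have dV : is_derive (dist p w i j) 1 V (derive1 V (dist p w i j)).
    by apply/derivable1_deriv/V_derivable/dist_gt.
  have D := is_derive1_compose (g := fun r => dist p (z r) i j) dV
    (dist_deriv hw hz ji).
  by apply: (is_derive1_eq D); rewrite -/w -/(vx i) -/(vx j) -/(vy i) -/(vy j); ring.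
have d5 i : is_derive t 1 (fun r => (cos (theta (z r) i) - cos phi)^-1 - (1 - cos phi)^-1)
    (- (cos (theta w i) - cos phi) ^- 2 * (- sin (theta w i) * u w i)).
  have [_ _ th _] := hz i.
  have x0 : cos (theta (z t) i) - cos phi != 0.
    by rewrite gt_eqF// subr_gt0; exact: cos_theta_gt.
  have D := is_derive1V (f := fun r => cos (theta (z r) i) - cos phi) x0
    (is_derive1B (is_derive1_compose (is_derive_cos _) th)
      (is_derive1_cst (cos phi) t)).
  apply: is_derive1_eq (is_derive1B D (is_derive1_cst (1 - cos phi)^-1 t)) _.
  by rewrite !subr0.
have D1 := is_derive1Z 2^-1 (is_derive1_sum (index_enum 'I_n) (P := predT) (fun i _ => d1 i)).
have D2 := is_derive1Z 2^-1 (is_derive1_sum (index_enum 'I_n) (P := predT) (fun i _ => d2 i)).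
have D3 := is_derive1_sum (index_enum 'I_n) (P := predT) (fun i _ => d3 i).
have D4 := is_derive1Z 2^-1 (is_derive1_sum (index_enum 'I_n) (P := predT)
  (fun i _ => is_derive1_sum (index_enum 'I_n) (P := fun j => j != i) (d4 i))).
have D5 := is_derive1Z A (is_derive1_sum (index_enum 'I_n) (P := predT) (fun i _ => d5 i)).
apply: is_derive1_eq
  (is_derive1D (is_derive1D (is_derive1D (is_derive1D D1 D2) D3) D4) D5) _.
(* The pair potentials come with relative velocities; antisymmetry of the pair forces regroups them
   by vehicle, and the resulting factor 2 cancels 2^-1. *)
under [X in _ + 2^-1 * X + _]eq_bigr do rewrite big_split/=.
rewrite big_split/= antisym_pair_sum; last first.
  by move=> i j; rewrite dist_sym; ring.
rewrite antisym_pair_sum; last by move=> i j; rewrite dist_sym; ring.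
have -> : - dissipation w = \sum_(i < n) (vstar * X w i -
    (K w i * (speed w i * cos (theta w i) - vstar) ^+ 2
     + mu1 * (speed w i * sin (theta w i)) ^+ 2)).
  by rewrite sumrB -mulr_sumr sum_X_eq0 mulr0 sub0r.
have half (x y : R) : 2^-1 * (2 * x + 2 * y) = x + y by field.
rewrite half 2![2^-1 * _]mulr_sumr [A * _]mulr_sumr -!big_split/=.
apply: eq_bigr => i _; rewrite -(dissipation_term i hw) -/w -/(vx i) -/(vy i).
rewrite /Xforce /Yforce -mulr_sumr.
set S1 := \sum_(j < n | _) _; set S2 := \sum_(j < n | _) _.
set r := _ ^- 2; lra.
Qed.

Local Notation Rb := (Rbound lambda L p A phi vmax vstar mu2 V f rho).

(** * A priori confinement of true solutions *)

Definition thmax s : R := acos (cmin s).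

Let cmin_acos s : 0 <= s -> -1 <= cmin s <= 1.
Proof.
move=> s0; rewrite cmin_le1// andbT; apply: le_trans (ltW (cmin_gt s0)).
by case/andP: cphi_itv; lra.
Qed.

Lemma thmax_itv s : 0 <= s -> 0 <= thmax s < phi.
Proof.
move=> s0; have hc := cmin_acos s0; rewrite /thmax acos_ge0//=.
have /andP[p0 ppi] := phi_lt_pi; have cs := cmin_gt s0.
rewrite ltNge le_eqVlt; apply/negP => /predU1P[e|].
  by move: cs; rewrite e acosK ?ltxx// in_itv.
move=> hp'; have : cos (acos (cmin s)) < cos phi.
  by apply: cos_lt_norm; [rewrite gtr0_norm|exact: acos_lepi].
by rewrite acosK ?in_itv// ltNge ltW.
Qed.

Lemma norm_theta_le s w i : Om w -> H w <= s -> `|theta w i| <= thmax s.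
Proof.
move=> hw Hs; have s0 := le_trans (energy_ge0 hw) Hs; have hc := cmin_acos s0.
rewrite leNgt; apply/negP => h.
have : cos `|theta w i| < cos (thmax s).
  apply: cos_lt_norm; first by rewrite ger0_norm//; case/andP: (thmax_itv s0).
  by apply: ltW; apply: lt_trans (theta_lt hw i) _; case/andP: phi_lt_pi.
by rewrite cos_norm acosK ?in_itv// ltNge cmin_le_cos.
Qed.

(* Within [speed_gap s] of either end of (0, vmax), the constant inward term of
   [accel_ge] or [accel_le] dominates the damping term, of slope at most [Rb s]. *)
Definition speed_gap s : R :=
  Num.min (mu2 * vstar / Rb s) (mu2 * (vmax - vstar / cmin s) / Rb s).

(** The initial value of the big minimum is [speed_gap (H w)]: besides fitting the speeds of w, the
    interval from [margin w] to [vmax - margin w] is thereby forward invariant. *)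
Definition margin w : R := \big[Num.min/speed_gap (H w)]_(i < n)
  Num.min (speed w i) (vmax - speed w i).

Lemma speed_gap_gt0 s : 0 <= s -> 0 < speed_gap s.
Proof.
move=> s0; have R0 : 0 < Rb s by apply: lt_le_trans hmu2 (Rb_ge s0).
have v0 := vstar_gt0; have /andP[c0 _] := cphi_itv; have cs := cmin_gt s0.
rewrite lt_min !divr_gt0 ?mulr_gt0//= subr_gt0 ltr_pdivrMr; last exact: lt_trans cs.
by apply: le_lt_trans vstar_le_cphi _; rewrite ltr_pM2l.
Qed.

Lemma margin_gt0 w : Om w -> 0 < margin w.
Proof.
move=> hw; apply: lt_bigmin => [|i _]; first exact/speed_gap_gt0/energy_ge0.
by have /andP[h1 h2] := speed_itv hw i; rewrite lt_min h1 subr_gt0.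
Qed.

Lemma margin_le_gap w : margin w <= speed_gap (H w).
Proof. exact: bigmin_le_id. Qed.

Lemma margin_le_speed w i : margin w <= speed w i <= vmax - margin w.
Proof.
have : margin w <= Num.min (speed w i) (vmax - speed w i) by exact: bigmin_le_cond.
by rewrite le_min; lra.
Qed.

(** The longitudinal positions are restricted only through distances: the vehicles drift forward
    without bound. *)
Definition box ky th dl rr w : Prop := forall i,
  [/\ `|py w i| <= ky, `|theta w i| <= th, dl <= speed w i <= vmax - dl
    & forall j, j != i -> rr <= dist p w i j].

Lemma box_Omega ky th dl rr w : ky < a -> th < phi -> 0 < dl -> L < rr ->
  box ky th dl rr w -> Om w.
Proof.
move=> hky hth hdl hrr hw; split => [i|i j ji]; have [] := hw i.
  move=> yi ti vi _; split.
  - by rewrite -ltr_norml (le_lt_trans yi).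
  - by rewrite -ltr_norml (le_lt_trans ti).
  - by lra.
by move=> _ _ _ /(_ j ji); exact: lt_le_trans.
Qed.

Lemma accel_ge s w i : Om w -> H w <= s ->
  mu2 * vstar - Rb s * speed w i <= F w i.
Proof.
move=> hw Hs; rewrite (accelE hw).
have c0 := cos_theta_gt0 hw i; have v0 := vstar_gt0.
have /andP[sp0 _] := speed_itv hw i.
have := gain_le hw Hs i; rewrite -(ler_pM2r sp0).
set T := _ / _ * f _.
have T0 : 0 <= T.
  rewrite mulr_ge0 ?f_ge0//; apply: le_trans (gain_coef_ge hw i).
  by rewrite invr_ge0 ltW.
have : mu2 * vstar <= vstar / cos (theta w i) * (mu2 + T).
  rewrite mulrC ler_pM ?(ltW v0) ?(ltW hmu2)//; last by rewrite lerDl.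
  by rewrite ler_pdivlMr// ger_pMr// cos_le1.
lra.
Qed.

Lemma accel_le s w i : Om w -> H w <= s ->
  F w i <= Rb s * (vmax - speed w i) - mu2 * (vmax - vstar / cmin s).
Proof.
move=> hw Hs; have s0 := le_trans (energy_ge0 hw) Hs.
have c0 := cos_theta_gt0 hw i; have v0 := vstar_gt0; have hv := vmax_cos_gt hw i.
have /andP[_] := speed_itv hw i; rewrite -subr_gt0 => sp0.
have := gain_le hw Hs i; rewrite -(ler_pM2r sp0) => hK.
(* Expanded around v = vmax, the terms in X combine into - (vmax / vstar) (X + f(- X)), which is at
   most 0 since f(- X) >= - X. *)
have -> : F w i = K w i * (vmax - speed w i)
  - mu2 * (vmax - vstar / cos (theta w i)) - vmax / vstar * (X w i + f (- X w i)).
  rewrite (accelE hw) /gain; set fx := f _; field.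
  by rewrite !gt_eqF ?subr_gt0.
have h1 : 0 <= vmax / vstar * (X w i + f (- X w i)).
  rewrite mulr_ge0 ?divr_ge0 ?(ltW hvmax) ?(ltW v0)//; have := f_ge (- X w i); lra.
have h2 : mu2 * (vmax - vstar / cmin s) <= mu2 * (vmax - vstar / cos (theta w i)).
  rewrite ler_pM2l// lerD2l lerN2 ler_pM2l// lef_pV2 ?posrE//.
    exact: cmin_le_cos.
  by apply: lt_trans (cmin_gt s0); case/andP: cphi_itv.
lra.
Qed.

Section APriori.
Variables (z : R -> state R n) (b : R).
Hypothesis (hz : forall t, 0 <= t <= b -> Om (z t) /\ flow z t).

Lemma energy_nonincreasing t : 0 <= t <= b -> H (z t) <= H (z 0).
Proof.
move=> /andP[t0 tb]; rewrite -lerN2.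
apply: (@deriv_ge0_le _ (fun r => - H (z r))
  (fun r => - - dissipation (z r)) _ _ t0) => r /andP[r0 rt].
  have [hr fr] : Om (z r) /\ flow z r by apply: hz; rewrite r0 (le_trans rt).
  by apply: is_derive1N; exact: energy_deriv.
have [hr fr] : Om (z r) /\ flow z r by apply: hz; rewrite r0 (le_trans rt).
rewrite opprK sumr_ge0// => i _.
rewrite addr_ge0// mulr_ge0 ?sqr_ge0// ?(ltW hmu1)//.
exact: le_trans (ltW hmu2) (gain_ge hr i).
Qed.

Lemma a_priori_box t : 0 <= t <= b ->
  box (kappa (H (z 0))) (thmax (H (z 0))) (margin (z 0)) (rho (H (z 0))) (z t).
Proof.
move=> tb i; have [ht _] := hz tb; have Ht := energy_nonincreasing tb.
have h0 : 0 <= H (z 0) := le_trans (energy_ge0 ht) Ht.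
have R0 : 0 < Rb (H (z 0)) by apply: lt_le_trans hmu2 (Rb_ge h0).
(* With q the distance of a speed to an end of the interval, these two bounds together with
   [accel_ge] and [accel_le] give q' >= - R q. *)
have := margin_le_gap (z 0); rewrite le_min !ler_pdivlMr// => /andP[g1 g2].
have /andP[m1 m2] := margin_le_speed (z 0) i.
split; [exact: (py_le_kappa ht)|exact: norm_theta_le| |exact: (rho_le_dist ht)].
case/andP: tb => t0 tb.
have sub r : 0 <= r <= t -> 0 <= r <= b by move=> /andP[-> /le_trans->].
apply/andP; split; rewrite -subr_ge0.
  have d (r : R) : 0 <= r <= t ->
      is_derive r 1 (fun r => speed (z r) i - margin (z 0)) (F (z r) i - 0).
    move=> /sub/hz[_ /(_ i)[_ _ _ dv]].
    exact: is_derive1B dv (is_derive1_cst _ _).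
  apply: (ge0_of_deriv_ge (k := Rb (H (z 0))) t0 d).
  - move=> r /sub rb; have [hr _] := hz rb.
    have := accel_ge i hr (energy_nonincreasing rb); lra.
  - by rewrite subr_ge0.
have d (r : R) : 0 <= r <= t ->
    is_derive r 1 (fun r => vmax - margin (z 0) - speed (z r) i) (0 - F (z r) i).
  move=> /sub/hz[_ /(_ i)[_ _ _ dv]].
  exact: is_derive1B (is_derive1_cst _ _) dv.
apply: (ge0_of_deriv_ge (k := Rb (H (z 0))) t0 d).
- move=> r /sub rb; have [hr _] := hz rb.
  have := accel_le i hr (energy_nonincreasing rb); lra.
- by rewrite subr_ge0.
Qed.

End APriori.

(** * The cut-off field *)

(** The feedback with X, Y, U', cos theta, sin theta and v as independent arguments, so that clamped
    quantities can be substituted for them. *)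
Definition gain_fun (X0 c : R) : R :=
  mu2 + vstar^-1 * X0 + vmax * c / (vstar * (vmax * c - vstar)) * f (- X0).

Definition accel_fun (X0 c v : R) : R :=
  - (gain_fun X0 c / c) * (v * c - vstar) - c^-1 * X0.

Definition steer_fun (X0 Y0 U'0 c sn v : R) : R :=
  - (vstar + A / (v * (c - cos phi) ^+ 2))^-1
  * (mu1 * v * sn + U'0 + p * Y0 + sn * accel_fun X0 c v).

Lemma trig_lipschitz c :
  (exists2 C, 0 <= C & forall x y, - c <= x <= c -> - c <= y <= c ->
     `|cos x - cos y| <= C * `|x - y| :> R) /\
  (exists2 C, 0 <= C & forall x y, - c <= x <= c -> - c <= y <= c ->
     `|sin x - sin y| <= C * `|x - y| :> R).
Proof.
have dcos : derive1 (@cos R) = (fun x => - sin x).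
  by apply/funext => x; rewrite derive1E derive_val.
have dsin : derive1 (@sin R) = cos.
  by apply/funext => x; rewrite derive1E derive_val.
split; apply: C1_lipschitz_cc => x _ //.
- by rewrite dcos; apply: continuousN; exact: continuous_sin.
- by rewrite dsin; exact: continuous_cos.
Qed.

Lemma f_lipschitz c :
  exists2 C, 0 <= C & forall x y, - c <= x <= c -> - c <= y <= c ->
     `|f x - f y| <= C * `|x - y|.
Proof.
by apply: C1_lipschitz_cc => x _; [exact: f_derivable|exact: f'_continuous].
Qed.

Section BlipFeedback.
Context {I : finType}.
Variables (X0 Y0 U0' c sn v : (I -> R) -> R) (e dl : R).
Hypotheses (bX : blip X0) (bY : blip Y0) (bU : blip U0') (bc : blip c)
  (bsn : blip sn) (bv : blip v).
Hypotheses (he : cos phi < e) (hc : forall z, e <= c z)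
  (hdl : 0 < dl) (hv : forall z, dl <= v z).

Let e0 : 0 < e. Proof. by apply: lt_trans he; case/andP: cphi_itv. Qed.

(** The strict inequality cos phi < e is essential: vmax cos phi = vstar is allowed, and the
    denominator of the gain may vanish at cos phi. *)
Lemma blip_gain : blip (fun z => gain_fun (X0 z) (c z)).
Proof.
have v0 := vstar_gt0.
have D0 : 0 < vstar * (vmax * e - vstar).
  rewrite mulr_gt0// subr_gt0; apply: le_lt_trans vstar_le_cphi _.
  by rewrite ltr_pM2l.
apply: blipD; first by apply: blipD (blip_cst _) (blipM (blip_cst _) bX).
apply: blipM; last first.
  by apply: (blip_comp f_lipschitz); exact: blipN.
apply: blipM; first exact: blipM (blip_cst _) bc.
apply: (blipV D0) => [z|].
  by rewrite ler_pM2l// lerD2r ler_pM2l.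
exact: blipM (blip_cst _) (blipB (blipM (blip_cst _) bc) (blip_cst _)).
Qed.

Lemma blip_accel : blip (fun z => accel_fun (X0 z) (c z) (v z)).
Proof.
have bci : blip (fun z => (c z)^-1) by exact: (blipV e0 hc bc).
apply: blipB; last exact: blipM.
apply: blipM (blipN (blipM blip_gain bci)) (blipB _ (blip_cst _)).
exact: blipM.
Qed.

Lemma blip_steer :
  blip (fun z => steer_fun (X0 z) (Y0 z) (U0' z) (c z) (sn z) (v z)).
Proof.
have v0 := vstar_gt0; have ex : 0 < e - cos phi by rewrite subr_gt0.
have x0 z : e - cos phi <= c z - cos phi by rewrite lerD2r.
have E0 : 0 < dl * (e - cos phi) ^+ 2 by rewrite mulr_gt0// exprn_gt0.
have DE z : dl * (e - cos phi) ^+ 2 <= v z * (c z - cos phi) ^+ 2.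
  apply: ler_pM => //; [exact: ltW|exact: sqr_ge0|].
  by rewrite ler_sqr ?nnegrE ?(ltW ex)// (le_trans (ltW ex)).
apply: blipM.
  apply: blipN; apply: (blipV v0) => [z|].
    by rewrite lerDl divr_ge0 ?(ltW hA)// (le_trans (ltW E0)).
  apply: blipD (blip_cst _) (blipM (blip_cst _) (blipV E0 DE _)).
  by apply: blipM bv (blip_sqr (blipB bc (blip_cst _))).
apply: blipD; last exact: blipM bsn blip_accel.
apply: blipD; last exact: blipM (blip_cst _) bY.
apply: blipD bU.
exact: blipM (blipM (blip_cst _) bv) bsn.
Qed.

End BlipFeedback.

Local Notation I := ('I_n + 'I_n + ('I_n + 'I_n))%type.

Definition to_state (z : I -> R) : state R n :=
  (\row_i z (inl (inl i)), \row_i z (inl (inr i)),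
   \row_i z (inr (inl i)), \row_i z (inr (inr i))).

Definition of_state w (k : I) : R :=
  match k with
  | inl (inl i) => px w i
  | inl (inr i) => py w i
  | inr (inl i) => theta w i
  | inr (inr i) => speed w i
  end.

Lemma to_stateE (z : I -> R) i :
  [/\ px (to_state z) i = z (inl (inl i)), py (to_state z) i = z (inl (inr i)),
      theta (to_state z) i = z (inr (inl i))
    & speed (to_state z) i = z (inr (inr i))].
Proof. by split; rewrite /px /py /theta /speed mxE. Qed.

Lemma of_stateK : cancel of_state to_state.
Proof.
move=> [[[x y] th] v]; rewrite /to_state.
by congr (_, _, _, _); apply/rowP => i; rewrite mxE /=
  ?/px ?/py ?/theta ?/speed/=.
Qed.

Lemma to_stateK : cancel to_state of_state.
Proof.
move=> z; apply/funext => -[[i|i]|[i|i]] /=; by have [] := to_stateE z i.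
Qed.

Section CutOff.
Variables ky th dl rr : R.
Hypotheses (ky0 : 0 <= ky) (kya : ky < a) (th0 : 0 <= th) (thphi : th < phi)
  (dl0 : 0 < dl) (dlv : dl <= vmax - dl) (Lrr : L < rr) (rrl : rr <= lambda).
Implicit Type z : I -> R.

Let cy z i := clamp (- ky) ky (z (inl (inr i))).
Let cth z i := clamp (- th) th (z (inr (inl i))).
Let cv z i := clamp dl (vmax - dl) (z (inr (inr i))).
Let dx z i j := z (inl (inl i)) - z (inl (inl j)).
Let dy z i j := z (inl (inr i)) - z (inl (inr j)).
Let cd z i j := clamp rr lambda (enorm p (dx z i j, dy z i j)).

(* Clamping the coordinate differences to [- lambda, lambda] changes nothing: a
   pair with a larger difference is further apart than lambda, where V' = 0. *)
Definition X_cut z i : R := \sum_(j < n | j != i)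
  derive1 V (cd z i j) * (clamp (- lambda) lambda (dx z i j) / cd z i j).

Definition Y_cut z i : R := \sum_(j < n | j != i)
  derive1 V (cd z i j) * (clamp (- lambda) lambda (dy z i j) / cd z i j).

Definition field_cut z (k : I) : R :=
  match k with
  | inl (inl i) => cv z i * cos (cth z i)
  | inl (inr i) => cv z i * sin (cth z i)
  | inr (inl i) => steer_fun (X_cut z i) (Y_cut z i) (derive1 U (cy z i))
                     (cos (cth z i)) (sin (cth z i)) (cv z i)
  | inr (inr i) => accel_fun (X_cut z i) (cos (cth z i)) (cv z i)
  end.

(** A globally Lipschitz copy of the dissipation, which supplies the modulus of continuity in time
    for Barbalat's lemma. *)
Definition dissipation_cut z : R :=
  \sum_(i < n) (gain_fun (X_cut z i) (cos (cth z i))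
                  * (cv z i * cos (cth z i) - vstar) ^+ 2
                + mu1 * (cv z i * sin (cth z i)) ^+ 2).

Let lambda_gt0 : 0 < lambda. Proof. exact: lt_trans hlambda. Qed.

Let lip_dx i j : lipschitz_fun (fun z => dx z i j).
Proof. exact: lipschitzD (lipschitz_coord _) (lipschitzN (lipschitz_coord _)). Qed.

Let lip_dy i j : lipschitz_fun (fun z => dy z i j).
Proof. exact: lipschitzD (lipschitz_coord _) (lipschitzN (lipschitz_coord _)). Qed.

Let lip_d i j : lipschitz_fun (fun z => enorm p (dx z i j, dy z i j)).
Proof. exact: lipschitz_enorm p_ge0 (lip_dx i j) (lip_dy i j). Qed.

Let blip_cd i j : blip (fun z => cd z i j).
Proof. exact: blip_clamp (lip_d i j). Qed.

Let blip_V' i j : blip (fun z => derive1 V (cd z i j)).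
Proof.
apply: (blip_comp_clamp rrl _ (lip_d i j)).
apply: C1_lipschitz_cc => x /andP[rx _].
  by apply: V'_derivable; exact: lt_le_trans rx.
by apply: V''_continuous; exact: lt_le_trans rx.
Qed.

Let blip_cdV i j : blip (fun z => (cd z i j)^-1).
Proof.
apply: (blipV (lt_trans hL Lrr)) => // z.
by case/andP: (clamp_itv (enorm p (dx z i j, dy z i j)) rrl).
Qed.

Let lamN : - lambda <= lambda. Proof. by have := lambda_gt0; lra. Qed.

Let blip_X i : blip (fun z => X_cut z i).
Proof.
apply: blip_sum => j _; apply: blipM (blip_V' i j) (blipM _ (blip_cdV i j)).
exact: blip_clamp lamN (lip_dx i j).
Qed.

Let blip_Y i : blip (fun z => Y_cut z i).
Proof.
apply: blip_sum => j _; apply: blipM (blip_V' i j) (blipM _ (blip_cdV i j)).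
exact: blip_clamp lamN (lip_dy i j).
Qed.

Let thN : - th <= th. Proof. by apply: le_trans th0; rewrite oppr_le0. Qed.

Let blip_cth i : blip (fun z => cth z i).
Proof. exact: blip_clamp thN (lipschitz_coord _). Qed.

Let blip_cos i : blip (fun z => cos (cth z i)).
Proof. exact: blip_comp (fun c => (trig_lipschitz c).1) (blip_cth i). Qed.

Let blip_sin i : blip (fun z => sin (cth z i)).
Proof. exact: blip_comp (fun c => (trig_lipschitz c).2) (blip_cth i). Qed.

Let blip_v i : blip (fun z => cv z i).
Proof. exact: blip_clamp dlv (lipschitz_coord _). Qed.

Let blip_U' i : blip (fun z => derive1 U (cy z i)).
Proof.
have kyN : - ky <= ky by apply: le_trans ky0; rewrite oppr_le0.
apply: (blip_comp_clamp kyN _ (lipschitz_coord _)).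
have sub x : - ky <= x <= ky -> - a < x < a.
  move=> /andP[kx xk]; rewrite (le_lt_trans xk)// andbT.
  by apply: lt_le_trans kx; rewrite ltrN2.
by apply: C1_lipschitz_cc => x /sub; [exact: U'_derivable|exact: U''_continuous].
Qed.

Let cos_cth_ge z i : cos th <= cos (cth z i).
Proof.
have := clamp_itv (z (inr (inl i))) thN; rewrite -ler_norml -/(cth z i).
rewrite le_eqVlt => /predU1P[<-|h]; first by rewrite cos_norm.
apply/ltW/cos_lt_norm => //; apply: ltW; apply: lt_trans thphi _.
by case/andP: phi_lt_pi.
Qed.

Let cos_th_gt : cos phi < cos th.
Proof.
apply: cos_lt_norm; first by rewrite ger0_norm.
by case/andP: phi_lt_pi => _ /ltW.
Qed.

Let cv_ge z i : dl <= cv z i.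
Proof. by case/andP: (clamp_itv (z (inr (inr i))) dlv). Qed.

Lemma blip_field_cut k : blip (fun z => field_cut z k).
Proof.
case: k => [[i|i]|[i|i]] /=.
- exact: blipM.
- exact: blipM.
- exact: (blip_steer (blip_X i) (blip_Y i) (blip_U' i) (blip_cos i) (blip_sin i)
    (blip_v i) cos_th_gt (fun z => cos_cth_ge z i) dl0 (fun z => cv_ge z i)).
- exact: (blip_accel (blip_X i) (blip_cos i) (blip_v i) cos_th_gt
    (fun z => cos_cth_ge z i)).
Qed.

Lemma blip_dissipation_cut : blip dissipation_cut.
Proof.
apply: blip_sum => i _; apply: blipD.
  apply: blipM; last by apply: blip_sqr (blipB (blipM _ _) (blip_cst _)).
  exact: (blip_gain (blip_X i) (blip_cos i) cos_th_gt (fun z => cos_cth_ge z i)).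
by apply: blipM (blip_cst _) (blip_sqr (blipM _ _)).
Qed.

Section InBox.
Variable w : state R n.
Hypothesis hw : box ky th dl rr w.
Local Notation z := (of_state w).

Let cdE i j : j != i -> dist p w i j <= lambda -> cd z i j = dist p w i j.
Proof. by move=> ji dl'; rewrite /cd clamp_id// dl' andbT; have [_ _ _] := hw i; apply. Qed.

Let cd_far i j : lambda < dist p w i j -> derive1 V (cd z i j) = 0.
Proof.
move=> ld; rewrite V'_eq0// /cd /clamp le_min lexx andbT.
by apply: le_trans (ltW ld) _; rewrite le_max lexx.
Qed.

Lemma X_cutE i : X_cut z i = X w i.
Proof.
apply: eq_bigr => j ji; have [near|far] := leP (dist p w i j) lambda.
  rewrite cdE// clamp_id// -ler_norml; apply: le_trans near.
  exact: (norm_fst_le_enorm (px w i - px w j, py w i - py w j) p_ge0).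
by rewrite cd_far// V'_eq0 ?mul0r// ltW.
Qed.

Lemma Y_cutE i : Y_cut z i = Y w i.
Proof.
apply: eq_bigr => j ji; have [near|far] := leP (dist p w i j) lambda.
  rewrite cdE// clamp_id// -ler_norml; apply: le_trans near.
  apply: le_trans (norm_snd_le_enorm (px w i - px w j, py w i - py w j) p_ge0).
  (* From p >= 1 follows |y_i - y_j| <= sqrt p |y_i - y_j| <= d_{i,j}, so the lateral clamp is
     inactive too. *)
  by rewrite ler_peMl// -sqrtr1 ler_sqrt// p_ge0.
by rewrite cd_far// V'_eq0 ?mul0r// ltW.
Qed.

Let clampsE i : [/\ cy z i = py w i, cth z i = theta w i & cv z i = speed w i].
Proof.
by have [yi ti vi _] := hw i; rewrite /cy /cth /cv; split;
  rewrite clamp_id// -ler_norml.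
Qed.

Lemma field_cutE i :
  [/\ field_cut z (inl (inl i)) = speed w i * cos (theta w i),
      field_cut z (inl (inr i)) = speed w i * sin (theta w i),
      field_cut z (inr (inl i)) = u w i
    & field_cut z (inr (inr i)) = F w i].
Proof.
have [yE tE vE] := clampsE i.
by split; rewrite /field_cut ?X_cutE ?Y_cutE ?yE ?tE ?vE.
Qed.

Lemma dissipation_cutE : dissipation_cut z = dissipation w.
Proof.
by apply: eq_bigr => i _; have [_ tE vE] := clampsE i; rewrite X_cutE tE vE.
Qed.

End InBox.

End CutOff.

(** * Closed-loop solutions *)

Definition field w (k : I) : R :=
  match k with
  | inl (inl i) => speed w i * cos (theta w i)
  | inl (inr i) => speed w i * sin (theta w i)
  | inr (inl i) => u w i
  | inr (inr i) => F w i
  end.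

Lemma flowP z t :
  flow z t <-> forall k, is_derive t 1 (fun r => of_state (z r) k) (field (z t) k).
Proof.
split=> [hz [[i|i]|[i|i]]|hz i]; first by have [] := hz i.
- by have [] := hz i.
- by have [] := hz i.
- by have [] := hz i.
split.
- exact: hz (inl (inl i)).
- exact: hz (inl (inr i)).
- exact: hz (inr (inl i)).
- exact: hz (inr (inr i)).
Qed.

Lemma field_cut_box ky th dl rr w k : box ky th dl rr w -> L < rr -> rr <= lambda ->
  field_cut ky th dl rr (of_state w) k = field w k.
Proof.
move=> hw Lr rl.
by case: k => [[i|i]|[i|i]]; have [] := field_cutE hw i.
Qed.

(** Each coordinate difference moves by at most 2 e, hence by [enorm_lip] each distance by at most 2
    e + sqrt p * 2 e. *)
Lemma box_perturb ky th dl rr e w w' :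
  (forall k, `|of_state w' k - of_state w k| <= e) -> box ky th dl rr w ->
  box (ky + e) (th + e) (dl - e) (rr - (2 + 2 * Num.sqrt p) * e) w'.
Proof.
move=> hk hw i; have [yi ti vi di] := hw i.
have hx j : `|px w' j - px w j| <= e := hk (inl (inl j)).
have hy j : `|py w' j - py w j| <= e := hk (inl (inr j)).
split.
- have := hy i; move: yi; rewrite !ler_norml; lra.
- have := hk (inr (inl i)); rewrite /=; move: ti; rewrite !ler_norml; lra.
- have := hk (inr (inr i)); rewrite /= ler_norml; lra.
move=> j ji; have := di j ji.
have := enorm_lip (px w' i - px w' j, py w' i - py w' j)
  (px w i - px w j, py w i - py w j) p_ge0.
rewrite /= -/(dist p w' i j) -/(dist p w i j) => h.
have h1 : `|px w' i - px w' j - (px w i - px w j)| <= 2 * e.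
  by have := hx i; have := hx j; rewrite !ler_norml; lra.
have h2 : `|py w' i - py w' j - (py w i - py w j)| <= 2 * e.
  by have := hy i; have := hy j; rewrite !ler_norml; lra.
have h3 := ler_wpM2l (sqrtr_ge0 p) h2.
by move: h; rewrite ler_norml; lra.
Qed.

Lemma box_sub ky th dl rr ky' th' dl' rr' w :
  ky <= ky' -> th <= th' -> dl' <= dl -> rr' <= rr ->
  box ky th dl rr w -> box ky' th' dl' rr' w.
Proof.
move=> hy ht hd hr hw i; have [yi ti vi di] := hw i; split.
- exact: le_trans hy.
- exact: le_trans ht.
- lra.
- by move=> j /di; exact: le_trans.
Qed.

(** Left of 0 every coordinate follows its tangent line, where the state may leave Omega; the
    conclusions therefore concern only times t >= 0. *)
Lemma extend_solution w0 (T : \bar R) (w : R -> state R n) :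
  is_solution u F Om w0 T w ->
  exists w' : R -> state R n, w' 0 = w0 /\
    forall t, 0 <= t -> (t%:E < T)%E -> [/\ w' t = w t, Om (w' t) & flow w' t].
Proof.
move=> [wE hw].
pose ext k r := if r < 0 then of_state (w 0) k + r * field (w 0) k
                else of_state (w r) k.
exists (fun r => to_state (fun k => ext k r)).
have extE t : 0 <= t -> to_state (fun k => ext k t) = w t.
  move=> t0; rewrite -[RHS]of_stateK; congr to_state; apply/funext => k.
  by rewrite /ext ltNge t0.
split; first by rewrite extE.
move=> t t0 tT; have [ht _] := hw t (conj t0 tT).
split; rewrite ?extE//; apply/flowP => k; rewrite extE//.
under eq_fun do rewrite to_stateK.
apply: (@tangent_extension _ T (fun r => of_state (w r) k) (fun r => field (w r) k)) => //.
move=> r r0 rT; have [_ hr] := hw r (conj r0 rT).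
by case: k => [[i|i]|[i|i]]; have [] := hr i.
Qed.

(** * Global existence and uniqueness from a given initial state *)

Section Solution.
Hypothesis hn : (1 <= n)%N.
Variable w0 : state R n.
Hypothesis hw0 : Om w0.

Let s0 := H w0.
Let s0_ge0 : 0 <= s0. Proof. exact: energy_ge0. Qed.
(** Midpoints between the a priori bounds and the boundary values a, phi, 0 and L: the larger box
    contains the small one with room to spare and still lies in Omega. *)
Let ky := (kappa s0 + a) / 2.
Let th := (thmax s0 + phi) / 2.
Let dl := margin w0 / 2.
Let rr := (rho s0 + L) / 2.

Let ky_itv : [/\ kappa s0 < ky, 0 <= ky & ky < a].
Proof. by have /andP[? ?] := kappa_itv s0_ge0; rewrite /ky; split; lra. Qed.

Let th_itv : [/\ thmax s0 < th, 0 <= th & th < phi].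
Proof. by have /andP[? ?] := thmax_itv s0_ge0; rewrite /th; split; lra. Qed.

Let dl_itv : [/\ dl < margin w0, 0 < dl & dl <= vmax - dl].
Proof.
(* The speed of some vehicle lies between [margin w0] and [vmax - margin w0], so the speed interval
   of the box is nonempty; this uses 1 <= n. *)
have m0 := margin_gt0 hw0; have := margin_le_speed w0 (Ordinal hn).
by rewrite /dl => /andP[? ?]; split; lra.
Qed.

Let rr_itv : [/\ rr < rho s0, L < rr & rr <= lambda].
Proof. by have /andP[? ?] := rho_itv s0_ge0; rewrite /rr; split; lra. Qed.

Let small := box (kappa s0) (thmax s0) (margin w0) (rho s0).
Let large := box ky th dl rr.
Let G := field_cut ky th dl rr.

Let small_large w : small w -> large w.
Proof.
have [? _ _] := ky_itv; have [? _ _] := th_itv; have [? _ _] := dl_itv.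
by have [? _ _] := rr_itv; apply: box_sub; exact: ltW.
Qed.

Let large_Om w : large w -> Om w.
Proof.
have [_ _ ?] := ky_itv; have [_ _ ?] := th_itv; have [_ ? _] := dl_itv.
by have [_ ? _] := rr_itv; apply: box_Omega.
Qed.

Let G_field w k : large w -> G (of_state w) k = field w k.
Proof. by have [_ ? ?] := rr_itv; move=> hw; exact: field_cut_box. Qed.

Let blip_G k : blip (fun z => G z k).
Proof.
have [_ ? ?] := ky_itv; have [_ ? ?] := th_itv; have [_ ? ?] := dl_itv.
by have [_ ? ?] := rr_itv; exact: blip_field_cut.
Qed.

Let true_small z b : z 0 = w0 ->
  (forall t, 0 <= t <= b -> Om (z t) /\ flow z t) ->
  forall t, 0 <= t <= b -> small (z t).
Proof.
by move=> z0 hz t tb; have := a_priori_box hz tb; rewrite z0.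
Qed.

Let cut_flow (z : R -> I -> R) (t : R) :
  (forall k, is_derive t 1 (fun r => z r k) (G (z t) k)) ->
  large (to_state (z t)) -> flow (fun r => to_state (z r)) t.
Proof.
move=> dz ht; apply/flowP => k; rewrite -G_field// to_stateK.
by under eq_fun do rewrite to_stateK; exact: dz.
Qed.

Lemma cutoff_solution : exists z : R -> I -> R,
  [/\ z 0 = of_state w0,
      forall t, 0 <= t -> large (to_state (z t))
    & forall k (t : R), 0 <= t -> is_derive t 1 (fun r => z r k) (G (z t) k)].
Proof.
have [M [C [M0 C0 GM GC]]] := blip_uniform blip_G.
have [z [z0 dz]] := @picard_lindelof R _ G M C (of_state w0)
  (fun y k => GM k y) (fun y y' k => GC k y y').
have z0E : z 0 = of_state w0 by apply/funext.
exists z; split => //.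
(* g is the least gap between the two boxes, q the constant of [box_perturb], e = g / q a
   displacement that does not exhaust the gap, and eta a time in which a motion of speed at most M
   covers at most e. M + 1 avoids a division by 0. *)
pose q := 2 + 2 * Num.sqrt p; have q2 : 2 <= q.
  by rewrite lerDl mulr_ge0// sqrtr_ge0.
pose g := Num.min (Num.min (ky - kappa s0) (th - thmax s0))
                  (Num.min (margin w0 - dl) (rho s0 - rr)).
have g0 : 0 < g.
  have [? _ _] := ky_itv; have [? _ _] := th_itv; have [? _ _] := dl_itv.
  by have [? _ _] := rr_itv; rewrite !lt_min !subr_gt0; apply/andP; split; apply/andP.
have [[g1 g2] [g3 g4]] : (g <= ky - kappa s0 /\ g <= th - thmax s0) /\
    (g <= margin w0 - dl /\ g <= rho s0 - rr).
  have : g <= g by []; rewrite {2}/g !le_min.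
  by move=> /andP[/andP[-> ->] /andP[-> ->]].
pose e := g / q; have e0 : 0 < e by rewrite divr_gt0//; lra.
have qe : q * e = g by rewrite /e mulrC divfK// gt_eqF//; lra.
have eg : e <= g by rewrite -qe -{1}[e]mul1r ler_pM2r//; lra.
pose eta := e / (M + 1); have eta0 : 0 < eta by rewrite divr_gt0//; lra.
have Meta : M * eta <= e.
  rewrite /eta mulrA ler_pdivrMr; last by lra.
  by have := ltW e0; lra.
(* Each step of length [eta] starts in the small box by the a priori bound, hence
   ends in the large one. *)
have main (k : nat) t : 0 <= t <= k%:R * eta -> large (to_state (z t)).
  elim: k t => [|k ih] t.
    rewrite mul0r => ht; have -> : t = 0 by lra.
    rewrite z0E of_stateK; apply: small_large.
    by move=> i; split; [exact: (py_le_kappa hw0)|exact: norm_theta_le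
        |exact: margin_le_speed|exact: (rho_le_dist hw0)].
  move=> /andP[t0 tk]; have [tk'|kt] := leP t (k%:R * eta); first by apply: ih; rewrite t0.
  set r := k%:R * eta in kt ih *; have r0 : 0 <= r by rewrite mulr_ge0// ltW.
  have hr : small (to_state (z r)).
    apply: (@true_small (fun x => to_state (z x)) r) => [|x xr|].
    - by rewrite z0E of_stateK.
    - have hx := ih x xr; split; first exact: large_Om.
      by apply: cut_flow => // k'; apply: dz; case/andP: xr.
    - by rewrite r0 lexx.
  have hk (c : I) :
      `|of_state (to_state (z t)) c - of_state (to_state (z r)) c| <= e.
    rewrite !to_stateK; apply: (@le_trans _ _ (M * (t - r))).
      apply: (@deriv_lip _ (fun x => z x c) (fun x => G (z x) c)); first exact: ltW.
        by move=> x /andP[rx _]; apply: dz; exact: le_trans rx.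
      by move=> x _; exact: GM.
    apply: le_trans Meta; rewrite ler_wpM2l//.
    by move: tk; rewrite -natr1 mulrDl mul1r -/r; lra.
  apply: box_sub (box_perturb hk hr); first by lra.
  - by lra.
  - by lra.
  - by rewrite -/q qe; lra.
move=> t t0; apply: (main (Num.truncn (t / eta)).+1); rewrite t0/=.
by rewrite -ler_pdivrMr// ltW// truncnS_gt.
Qed.

(** A true solution is confined to the small box by the a priori bounds, hence solves the cut-off
    system as well, to which uniqueness for a globally Lipschitz field applies. *)
Lemma solution_unique (z : R -> I -> R) (w : R -> state R n) (b : R) :
  z 0 = of_state w0 ->
  (forall k (t : R), 0 <= t -> is_derive t 1 (fun r => z r k) (G (z t) k)) ->
  w 0 = w0 -> (forall t, 0 <= t <= b -> Om (w t) /\ flow w t) ->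
  forall t, 0 <= t <= b -> w t = to_state (z t).
Proof.
move=> z0 dz wE hw t tb; rewrite -[LHS]of_stateK; congr to_state.
have [M [C [_ _ _ GC]]] := blip_uniform blip_G.
apply/funext => k.
apply: (@ode_unique R _ G C b (fun r => of_state (w r)) z) => //.
- by move=> i; rewrite wE z0.
- move=> i r rb; have hr := true_small wE hw rb.
  rewrite (G_field _ (small_large hr)); have [_ /flowP] := hw r rb; exact.
- by move=> i r /andP[r0 _]; exact: dz.
Qed.

(** * Asymptotic behaviour *)

Section Limits.
Variable z : R -> I -> R.
Hypotheses (z_large : forall t, 0 <= t -> large (to_state (z t)))
  (dz : forall k (t : R), 0 <= t -> is_derive t 1 (fun r => z r k) (G (z t) k)).

Let w t := to_state (z t).

Let w_flow t : 0 <= t -> flow w t.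
Proof. by move=> t0; apply: cut_flow; [move=> k; exact: dz|exact: z_large]. Qed.

Let w_Om t : 0 <= t -> Om (w t).
Proof. by move=> t0; exact/large_Om/z_large. Qed.

Let along_lipschitz (g : (I -> R) -> R) : blip g ->
  exists C, forall r t, 0 <= r -> r <= t -> `|g (z r) - g (z t)| <= C * (t - r).
Proof.
move=> [[C C0 hC] _]; have [M [_ [M0 _ GM _]]] := blip_uniform blip_G.
exists (C * (#|{: I}|%:R * M)) => r t r0 rt; apply: (le_trans (hC _ _)).
rewrite -mulrA ler_wpM2l// -mulrA; apply: l1dist_le => k; rewrite distrC.
apply: (@deriv_lip _ (fun x => z x k) (fun x => G (z x) k)) => // x /andP[rx _].
by apply: dz; exact: le_trans rx.
Qed.

Let dissipation_to0 : dissipation (w t) @[t --> +oo] --> 0.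
Proof.
have [_ k0 ka] := ky_itv; have [_ t0 tp] := th_itv; have [_ d0 dv] := dl_itv.
have [_ Lr rl] := rr_itv.
have bD : blip (dissipation_cut th dl rr) by exact: blip_dissipation_cut.
have [C hC] := along_lipschitz bD.
have E t : 0 <= t -> dissipation_cut th dl rr (z t) = dissipation (w t).
  by move=> t1; rewrite -(dissipation_cutE (z_large t1)) to_stateK.
have dH (t : R) : 0 <= t ->
    is_derive t 1 (fun t => - H (w t)) (- - dissipation (w t)).
  move=> t1; exact: is_derive1N (energy_deriv (w_Om t1) (w_flow t1)).
have dH' (t : R) : 0 <= t ->
    is_derive t 1 (fun t => - H (w t)) (dissipation_cut th dl rr (z t)).
  by move=> t1; apply: is_derive1_eq (dH t t1) _; rewrite opprK E.
have : dissipation_cut th dl rr (z t) @[t --> +oo] --> 0.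
  apply: (barbalat dH' hC) => e e0.
  have [|t t1|N N0 hN] := @nonincreasing_cauchy _ (fun t => H (w t)) _ _ e e0.
  - move=> r t r0 rt; rewrite -lerN2.
    apply: (deriv_ge0_le rt (fun x xrt => dH x _)) => x /andP[rx _].
      exact: le_trans rx.
    have x0 := le_trans r0 rx; rewrite opprK sumr_ge0// => i _.
    rewrite addr_ge0// mulr_ge0 ?sqr_ge0// ?(ltW hmu1)//.
    exact: le_trans (ltW hmu2) (gain_ge (w_Om x0) i).
  - exact/energy_ge0/w_Om.
  - by exists N => // t /hN; rewrite -opprD normrN.
apply: cvg_trans; apply: near_eq_cvg; near=> t; apply: E.
by near: t; apply: nbhs_pinfty_ge; exact: num_real.
Unshelve. all: by end_near. Qed.

Let dissipation_small e : 0 < e -> \forall t \near +oo,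
  0 <= t /\ forall i, (speed (w t) i * cos (theta (w t) i) - vstar) ^+ 2 <= e /\
                      (speed (w t) i * sin (theta (w t) i)) ^+ 2 <= e.
Proof.
move=> e0; have mu0 : 0 < Num.min mu1 mu2 * e by rewrite mulr_gt0// lt_min hmu1.
have /cvgrPdist_le/(_ _ mu0) hD := dissipation_to0.
near=> t; have t0 : 0 <= t by near: t; apply: nbhs_pinfty_ge; exact: num_real.
split=> // i.
have : `|0 - dissipation (w t)| <= Num.min mu1 mu2 * e by near: t; exact: hD.
rewrite sub0r normrN => /(le_trans (ler_norm _)).
have term j : 0 <= K (w t) j * (speed (w t) j * cos (theta (w t) j) - vstar) ^+ 2
   /\ 0 <= mu1 * (speed (w t) j * sin (theta (w t) j)) ^+ 2.
  split; rewrite mulr_ge0 ?sqr_ge0 ?(ltW hmu1)//.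
  exact: le_trans (ltW hmu2) (gain_ge (w_Om t0) j).
rewrite /dissipation (bigD1 i)//=; set S := \sum_(j < n | _) _ => h.
have S0 : 0 <= S by apply: sumr_ge0 => j _; have [? ?] := term j; exact: addr_ge0.
have [h1 h2] := term i.
have m1 : Num.min mu1 mu2 * e <= mu1 * e by rewrite ler_pM2r// ge_min lexx.
have m2 : Num.min mu1 mu2 * e <= mu2 * e by rewrite ler_pM2r// ge_min lexx orbT.
split; last by rewrite -(ler_pM2l hmu1); lra.
rewrite -(ler_pM2l hmu2).
apply: (@le_trans _ _ (K (w t) i * (speed (w t) i * cos (theta (w t) i) - vstar) ^+ 2)).
  by rewrite ler_wpM2r ?sqr_ge0// (gain_ge (w_Om t0)).
lra.
Unshelve. all: by end_near. Qed.

(** The two dissipated squares are the squared components of the velocity minus (vstar, 0). Their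
    sum is at least (v - vstar)^2, because cos theta <= 1. *)
Lemma speed_to_vstar i : speed (w t) i @[t --> +oo] --> vstar.
Proof.
apply/cvgrPdist_le => /= e e0.
have e2 : 0 < e ^+ 2 / 2 by rewrite divr_gt0// exprn_gt0.
have hD := dissipation_small e2.
near=> t.
have [t0 /(_ i)[h1 h2]] : 0 <= t /\ forall i,
    (speed (w t) i * cos (theta (w t) i) - vstar) ^+ 2 <= e ^+ 2 / 2 /\
    (speed (w t) i * sin (theta (w t) i)) ^+ 2 <= e ^+ 2 / 2 by near: t; exact: hD.
have v0 := vstar_gt0; have /andP[sp0 _] := speed_itv (w_Om t0) i.
rewrite -ler_sqr ?nnegrE ?(ltW e0)// real_normK ?num_real//.
have c1 : speed (w t) i * vstar * cos (theta (w t) i) <= speed (w t) i * vstar.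
  by rewrite ger_pMr ?cos_le1// mulr_gt0.
have cs := cos2Dsin2 (theta (w t) i).
have : speed (w t) i ^+ 2 * (cos (theta (w t) i) ^+ 2 + sin (theta (w t) i) ^+ 2) =
       speed (w t) i ^+ 2 by rewrite cs mulr1.
move: h1 h2 c1; set v := speed _ _; set c := cos _; set sn := sin _; lra.
Unshelve. all: by end_near. Qed.

(** The lower bound dl on the speed passes from v sin theta to sin theta; [asin] then recovers
    theta, since |theta| < phi < pi / 2. *)
Lemma theta_to0 i : theta (w t) i @[t --> +oo] --> 0.
Proof.
have [_ d0 _] := dl_itv.
have sin_to0 : sin (theta (w t) i) @[t --> +oo] --> (0 : R).
  apply/cvgrPdist_le => /= e e0.
  have e2 : 0 < (dl * e) ^+ 2 by rewrite exprn_gt0// mulr_gt0.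
  have hD := dissipation_small e2.
  near=> t.
  have [t0 /(_ i)[_ h2]] : 0 <= t /\ forall i,
      (speed (w t) i * cos (theta (w t) i) - vstar) ^+ 2 <= (dl * e) ^+ 2 /\
      (speed (w t) i * sin (theta (w t) i)) ^+ 2 <= (dl * e) ^+ 2 by near: t; exact: hD.
  have [_ _ /andP[vd _] _] := z_large t0 i.
  rewrite sub0r normrN -(ler_pM2l d0).
  apply: (@le_trans _ _ (speed (w t) i * `|sin (theta (w t) i)|)).
    by rewrite ler_wpM2r.
  have de0 : 0 <= dl * e by exact: ltW (mulr_gt0 d0 e0).
  rewrite -ler_sqr ?nnegrE ?de0 ?mulr_ge0 ?(le_trans (ltW d0) vd)//.
  by rewrite exprMn real_normK ?num_real// -exprMn.
have asin0 : asin (0 : R) = 0.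
  by rewrite -[X in asin X]sin0 sinK// in_itv/= oppr_le0; have := pi_gt0 R; lra.
have : asin (sin (theta (w t) i)) @[t --> +oo] --> (asin 0 : R).
  apply: (continuous_cvg _ _ sin_to0).
  by apply: continuous_asin; rewrite ltrN10 ltr01.
rewrite asin0; apply: cvg_trans; apply: near_eq_cvg; near=> t.
have t0 : 0 <= t by near: t; apply: nbhs_pinfty_ge; exact: num_real.
rewrite sinK// in_itv/= -ler_norml ltW//.
by apply: lt_trans (theta_lt (w_Om t0) i) _; case/andP: hphi.
Unshelve. all: by end_near. Qed.

(** The value of l is irrelevant to the conclusion: convergence provides the Cauchy condition of
    Barbalat's lemma, and the cut-off field is Lipschitz in time along the solution. *)
Lemma field_to0 (k : I) (l : R) : of_state (w t) k @[t --> +oo] --> l ->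
  field (w t) k @[t --> +oo] --> 0.
Proof.
move=> hl; have [C hC] := along_lipschitz (blip_G k).
have : G (z t) k @[t --> +oo] --> 0.
  have e : (fun t => of_state (w t) k) = (fun t => z t k).
    by apply/funext => t; rewrite to_stateK.
  by rewrite e in hl; exact: (barbalat (dz k) hC (cvg_pinfty_cauchy hl)).
apply: cvg_trans; apply: near_eq_cvg; near=> t.
have t0 : 0 <= t by near: t; apply: nbhs_pinfty_ge; exact: num_real.
by rewrite -(G_field _ (z_large t0)) to_stateK.
Unshelve. all: by end_near. Qed.

End Limits.

Lemma well_posed :
  exists w : R -> state R n,
    [/\ is_solution u F Om w0 +oo%E w,
        (forall (T : \bar R) (w' : R -> state R n),
           is_solution u F Om w0 T w' ->
           forall t, 0 <= t -> (t%:E < T)%E -> w' t = w t)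
      & forall i : 'I_n,
          [/\ speed (w t) i @[t --> +oo] --> vstar,
              theta (w t) i @[t --> +oo] --> 0,
              u (w t) i @[t --> +oo] --> 0
            & F (w t) i @[t --> +oo] --> 0]].
Proof.
have [z [z0 hz dz]] := cutoff_solution.
exists (fun t => to_state (z t)); split.
- split=> [|t [t0 _]]; first by rewrite z0 of_stateK.
  split; first exact: (large_Om (hz t t0)).
  have hf' := cut_flow (fun k => dz k t t0) (hz t t0).
  by move=> i; have [] := hf' i; split; exact: deriv_has_deriv_within.
- move=> T w' /extend_solution[w1 [w10 hw1]] t t0 tT.
  have [<- _ _] := hw1 t t0 tT.
  apply: (@solution_unique z w1 t) => //; last by rewrite t0 lexx.
  move=> r /andP[r0 rt]; have rT : (r%:E < T)%E by apply: le_lt_trans tT; rewrite lee_fin.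
  by have [] := hw1 r r0 rT.
- move=> i; have hv := speed_to_vstar hz dz i.
  have ht := theta_to0 hz dz i.
  split => //.
    exact: (@field_to0 z hz dz (inr (inl i)) 0).
  exact: (@field_to0 z hz dz (inr (inr i)) vstar).
Qed.

End Solution.

Lemma feedback_bounds w0 : Om w0 -> forall w : R -> state R n, is_solution u F Om w0 +oo%E w ->
  forall t, 0 <= t -> forall i : 'I_n,
    `|F (w t) i| <= Rb (H w0) * vmax /\
    `|u (w t) i| <= vstar^-1 * ((mu1 + Rb (H w0)) * vmax + b2 U (kappa (H w0))
                         + m * Num.sqrt p * b1 lambda V (rho (H w0))).
Proof.
move=> hw0 w /extend_solution[w1 [w10 hw1]] t t0 i.
have [<- ht _] := hw1 t t0 (ltry t).
have Ht : H (w1 t) <= H w0.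
  rewrite -w10; apply: (@energy_nonincreasing w1 t) => [r /andP[r0 _]|].
    by have [] := hw1 r r0 (ltry r).
  by rewrite t0 lexx.
by split; [exact: norm_accel_le|exact: norm_steer_le].
Qed.

End Model.

Theorem theorem1 (R : realType) (n : nat)
    (a lambda L p A mu1 mu2 vmax vstar phi : R) (V U f : R -> R)
    (hn : (1 <= n)%N) (ha : 0 < a) (hL : 0 < L) (hlambda : L < lambda)
    (hp : 1 <= p) (hA : 0 < A) (hmu1 : 0 < mu1) (hmu2 : 0 < mu2)
    (hvmax : 0 < vmax) (hvstar : 0 < vstar < vmax)
    (hphi : 0 < phi < pi / 2) (hcos : vstar / vmax <= cos phi)
    (hVC2 : C_on 2 [set d | L < d] V)
    (hVge0 : forall d, L < d -> 0 <= V d)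
    (hVlim : V d @[d --> L^'+] --> +oo)
    (hV0 : forall d, lambda <= d -> V d = 0)
    (hUC2 : C_on 2 [set y | - a < y < a] U)
    (hUge0 : forall y, - a < y < a -> 0 <= U y)
    (hUliml : U y @[y --> (- a)^'+] --> +oo)
    (hUlimr : U y @[y --> a^'-] --> +oo)
    (hU0 : U 0 = 0)
    (hfC1 : C_on 1 [set: R] f)
    (hf : forall x, Num.max x 0 <= f x) :
  let Om : set (state R n) := Omega a phi vmax L p in
  let H := @energy R n p A phi vstar V U in
  let F := @accel R n p vmax vstar mu2 V f in
  let u := @steer R n p A phi vmax vstar mu1 mu2 V U f in
  let m : R := (max_packing p L lambda)%:R in
  (forall w0, Om w0 ->
     exists w : R -> state R n,
       [/\ is_solution u F Om w0 +oo%E w,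
           (forall (T : \bar R) (w' : R -> state R n),
              is_solution u F Om w0 T w' ->
              forall t, 0 <= t -> (t%:E < T)%E -> w' t = w t)
         & forall i : 'I_n,
             [/\ speed (w t) i @[t --> +oo] --> vstar,
                 theta (w t) i @[t --> +oo] --> 0,
                 u (w t) i @[t --> +oo] --> 0
               & F (w t) i @[t --> +oo] --> 0]])
  /\
  (exists kappa rho : R -> R,
     let Rb := Rbound lambda L p A phi vmax vstar mu2 V f rho in
     [/\ (forall s, 0 <= s -> 0 <= kappa s < a),
         (forall s s', 0 <= s -> s <= s' -> kappa s <= kappa s'),
         (forall s, 0 <= s -> L < rho s <= lambda),
         (forall s s', 0 <= s -> s <= s' -> rho s' <= rho s)
       & (forall s, 0 <= s -> 0 <= Rb s) /\
         forall w0, Om w0 -> forall w, is_solution u F Om w0 +oo%E w ->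
         forall t, 0 <= t -> forall i : 'I_n,
           `|F (w t) i| <= Rb (H w0) * vmax /\
           `|u (w t) i| <=
             vstar^-1 * ((mu1 + Rb (H w0)) * vmax + b2 U (kappa (H w0))
                         + m * Num.sqrt p * b1 lambda V (rho (H w0)))]).
Proof.
move=> Om H F u m; split.
  by move=> w0 hw0; apply: (@well_posed _ _ a lambda) => //; exact: hw0.
exists (kappa a U), (rho lambda L V) => Rb.
have b0 s : 0 <= s -> 0 <= Rb s.
  by move=> s0; apply: le_trans (ltW hmu2) _; apply: Rb_ge.
split=> [s s0|s s' s0 ss'|s s0|s s' s0 ss'|].
- exact: kappa_itv.
- exact: kappa_le.
- exact: rho_itv.
- exact: rho_ge.
by split=> // w0 hw0 w hw t t0 i; apply: feedback_bounds.
Qed.
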